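(* For any $R>0$, let $\bar\Gamma_{1:k}^{-1/2}=\sum_{j\le k}\min\big(\frac1R,\frac1{\sqrt{\sigma_j}}\big)\varphi_j\otimes\varphi_j$. For $c_R>0$ sufficiently small ($c_R<\frac1{100C_a^2C_b^2}$ is sufficient, where $C_a,C_b$ are absolute constants), let $$R_N(c_R)=\inf\left\{R>0:\ \Big\|\max_{i\in[N]}\|\bar\Gamma_{1:k}^{-1/2}\phi(X_i)\|_{\mathcal H}\Big\|_{L_\infty}\le c_R\frac{\sqrt N}{\log N}\right\}.$$ For any $0<\delta<1$, there exist absolute constants $c_l,C_u>0$ depending on $\delta$ such that when $R\ge R_N(c_R)$, with probability at least $1-\delta$, for all $f\in\mathrm{cone}(\mathcal C(R))$, where $$\mathcal C(R)=R^{-1}B_{\mathcal H_{1:k}}\cap\Gamma_{1:k}^{-1/2}S_{\mathcal H_{1:k}},\qquad\mathrm{cone}(\mathcal C(R))=\{f\in\mathcal H_{1:k}:\ R\|f\|_{\mathcal H}\le\|f\|_{L_2}\},$$ we have $$c_l\,\|\Gamma_{1:k}^{1/2}f\|_{\mathcal H}\le\frac1{\sqrt N}\|\mathbb X_{\phi,1:k}f\|_2\le C_u\,\|\Gamma_{1:k}^{1/2}f\|_{\mathcal H}.$$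
   Context: $\Omega\subset\mathbb R^d$ is a compact Hausdorff space, $\mu$ a probability measure on $\Omega$, $K$ a continuous positive definite kernel on $\Omega$ with $\|K\|_\infty\le1$ (the paper remarks that it is enough that $\Gamma$ below is positive, compact, symmetric and trace-class), $\mathcal H$ its RKHS, $\phi(x)=K(x,\cdot)$; $X_1,\dots,X_N$ are i.i.d. with law $\mu$ (the law of $X$). $\Gamma=\mathbb E[\phi(X)\otimes\phi(X)]$ has eigenvalues $\sigma_1\ge\sigma_2\ge\dots$ with $\mathcal H$-orthonormal eigenfunctions $(\varphi_j)$; $\mathcal H_{1:k}=\mathrm{span}(\varphi_j:j\le k)$; $\Gamma_{1:k}^{\pm1/2}=\sum_{j\le k}\sigma_j^{\pm1/2}\varphi_j\otimes\varphi_j$; $B_{\mathcal H_{1:k}},S_{\mathcal H_{1:k}}$ are the unit ball and unit sphere of $\mathcal H_{1:k}$; $(\mathbb X_{\phi,1:k}f)_i=\langle P\phi(X_i),f\rangle_{\mathcal H}$ with $P$ the orthogonal projection onto $\mathcal H_{1:k}$. $L_2=L_2(\mu)$, and $\|f\|_{L_2}=\|\Gamma^{1/2}f\|_{\mathcal H}$. The integer $k$ is not required to be smaller than $N$.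
   Formalization: The constants C_a, C_b, and so how small c_R must be, may depend on δ: with c_R fixed before δ the claim fails (Ω={0,1}, K(x,y)=xy, k=1: for small δ, all X_i=0 has probability above δ). *)

(* Defs.v *)
From HB Require Import structures.
From mathcomp Require Import all_boot all_order all_algebra.
From mathcomp Require Import all_classical all_reals all_analysis.

Set Implicit Arguments.
Unset Strict Implicit.
Unset Printing Implicit Defensive.

Import Order.TTheory GRing.Theory Num.Theory.
Import numFieldNormedType.Exports.

Local Open Scope classical_set_scope.
Local Open Scope ring_scope.

(* Measurable types are pointed, hence ptopologicalType: the spaces below are
   nonempty anyway, as they carry a probability measure. *)
Notation borelType T := (g_sigma_algebraType (@open T)).

Section Kernel.
Context {R : realType} {T : ptopologicalType}.

Definition positive_definite_kernel (K : T -> T -> R) : Prop :=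
  (forall x y, K x y = K y x) /\
  (forall (n : nat) (x : 'I_n -> T) (a : 'I_n -> R),
     0 <= \sum_(i < n) \sum_(j < n) a i * a j * K (x i) (x j)).

(* H, whose norm is complete and comes from the inner product ip, is the
   reproducing kernel Hilbert space of K: [ev] realizes its elements as
   functions on T, and [phi x] is the function K(x, .). *)
Record is_rkhs (K : T -> T -> R) (H : completeNormedModType R)
    (ip : H -> H -> R) (ev : H -> T -> R) (phi : T -> H) : Prop := IsRkhs {
  rkhs_ipC : forall f g, ip f g = ip g f ;
  rkhs_ip_linear : forall (a : R) f g h,
    ip (a *: f + g) h = a * ip f h + ip g h ;
  rkhs_norm : forall f : H, `|f| = Num.sqrt (ip f f) ;
  rkhs_ip_ge0 : forall f, 0 <= ip f f ;
  rkhs_ev_inj : injective ev ;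
  rkhs_ev_phi : forall x, ev (phi x) = K x ;
  rkhs_reproducing : forall f x, ev f x = ip f (phi x) }.

End Kernel.

Section Spectral.
Context {R : realType} {H : completeNormedModType R}.
Variable ip : H -> H -> R.

(* Gamma = E[phi(X) (x) phi(X)] for X of law mu, as a weak integral:
   <Gamma f, g> = E[<phi(X), f> <phi(X), g>]. *)
Definition is_second_moment {T : ptopologicalType}
    (mu : probability (borelType T) R) (phi : T -> H)
    (Gamma : H -> H) : Prop :=
  forall f g,
    ip (Gamma f) g = (\int[mu]_x (ip (phi x) f * ip (phi x) g))%R.

(* The eigenvalues of Gamma, with multiplicity and in nonincreasing order, and
   orthonormal eigenvectors. Indices start at 0: sigma j and e j stand for
   sigma_(j+1) and varphi_(j+1). If Gamma has finite rank, sigma is padded with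
   zeros, and then e j is arbitrary for every j with sigma j = 0. The last
   field says that no positive eigenvalue is missing. *)
Record is_spectral_decomposition (Gamma : H -> H) (sigma : nat -> R)
    (e : nat -> H) : Prop := IsSpectralDecomposition {
  spectral_ge0 : forall j, 0 <= sigma j ;
  spectral_nonincreasing : forall i j, (i <= j)%N -> sigma j <= sigma i ;
  spectral_orthonormal : forall i j, 0 < sigma i -> 0 < sigma j ->
    ip (e i) (e j) = (i == j)%:R ;
  spectral_eigen : forall j, 0 < sigma j -> Gamma (e j) = sigma j *: e j ;
  spectral_exhaustive : forall f,
    (forall j, 0 < sigma j -> ip (e j) f = 0) -> Gamma f = 0 }.

Variables (sigma : nat -> R) (e : nat -> H) (k : nat).

Definition span1k : set H :=
  [set f | exists a : 'I_k -> R, f = \sum_(j < k) a j *: e j].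

(* sum_(j <= k) w_j varphi_j (x) varphi_j *)
Definition diag_op (w : nat -> R) (f : H) : H :=
  \sum_(j < k) (w j * ip (e j) f) *: e j.

(* The orthogonal projection onto span1k when e 0, ..., e k.-1 is
   orthonormal. *)
Definition proj1k : H -> H := diag_op (fun=> 1).

Definition Gamma1k_half : H -> H := diag_op (fun j => Num.sqrt (sigma j)).

Definition Gamma1k_mhalf : H -> H := diag_op (fun j => (Num.sqrt (sigma j))^-1).

Definition barGamma1k_mhalf (r : R) : H -> H :=
  diag_op (fun j => Num.min r^-1 (Num.sqrt (sigma j))^-1).

(* C(r) = r^-1 B_(H_1:k) `&` Gamma_1:k^(-1/2) S_(H_1:k) *)
Definition setC1k (r : R) : set H :=
  [set r^-1 *: f | f in span1k `&` [set f : H | `|f| <= 1]] `&`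
  [set Gamma1k_mhalf f | f in span1k `&` [set f : H | `|f| = 1]].

End Spectral.

(* The origin is kept also when A is empty. *)
Definition cone {R : realType} {H : lmodType R} (A : set H) : set H :=
  [set 0] `|` [set f | exists t g, [/\ 0 < t, A g & f = t *: g]].

Section Sampling.
Context {R : realType} {dS : measure_display} {S : measurableType dS}.
Variable P : probability S R.
Context {T : ptopologicalType} {N : nat}.
Variable X : 'I_N -> {RV P >-> borelType T}.

Definition mutually_independent : Prop :=
  forall (J : {set 'I_N}) (A : 'I_N -> set (borelType T)),
    (forall i, measurable (A i)) ->
    P (\bigcap_(i in [set` J]) (X i @^-1` A i)) =
    (\prod_(i in J) P (X i @^-1` A i))%E.

Definition iid_with_law (mu : probability (borelType T) R) : Prop :=
  mutually_independent /\
  (forall i (A : set (borelType T)), measurable A ->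
     distribution P (X i) A = mu A).

Context {H : completeNormedModType R}.
Variables (ip : H -> H -> R) (phi : T -> H).
Variables (sigma : nat -> R) (e : nat -> H) (k : nat).

(* R_N(c); the bound on the right-hand side is meaningful for N >= 2 only. *)
Definition R_N (c : R) : R :=
  inf [set r : R | 0 < r /\
    ('N[P]_+oo[(fun w => (\big[Num.max/0]_(i < N)
        `|barGamma1k_mhalf ip sigma e k r (phi (X i w))|)%:E)]
     <= (c * (Num.sqrt N%:R / ln N%:R))%:E)%E].

(* |X_(phi,1:k) f|_2 at the sample point w *)
Definition design_norm (w : S) (f : H) : R :=
  Num.sqrt (\sum_(i < N) ip (proj1k ip e k (phi (X i w))) f ^+ 2).

End Sampling.

(* {f in H_1:k : r |f|_H <= |f|_(L_2(mu))} *)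
Definition coneC1k {R : realType} {T : ptopologicalType}
    (mu : probability (borelType T) R) {H : completeNormedModType R}
    (ev : H -> T -> R) (e : nat -> H) (k : nat) (r : R) : set H :=
  [set f | span1k e k f /\
    ((r * `|f|)%:E <= 'N[mu]_2%:E[(fun x => (ev f x)%:E)])%E].

(* Main.v *)
Require Import Defs.
From HB Require Import structures.
From mathcomp Require Import all_boot all_order all_algebra.
From mathcomp Require Import all_classical all_reals all_analysis.
From mathcomp Require Import measurable_realfun ess_sup_inf.
From mathcomp Require Import zify ring lra.
Import Order.TTheory GRing.Theory Num.Theory.
Import numFieldNormedType.Exports.
Local Open Scope classical_set_scope.
Local Open Scope ring_scope.

(** Let w_j = min(1/r, 1/sqrt(sigma_j)) and let y in R^k have the coordinates
    w_j <e_j, phi(X)>, so that |y| is the norm of barGamma_(1:k)^(-1/2) phi(X)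
    and E[y y^T] = D with D = diag(w_j^2 sigma_j) <= I. For f = sum_j a_j e_j
    put h_j = a_j / w_j. Then <h, y> = f(X) and <h, D h> = |f|_(L_2)^2, while f
    is in the cone exactly when r |f|_H <= |f|_(L_2), in which case
    |h|^2 <= 2 |f|_(L_2)^2 because 1/w_j^2 <= r^2 + sigma_j. Hence both
    inequalities follow, for all f of the cone at once, from
    |<h, W h>| <= N/4 |h|^2 for all h, where W = sum_i A_i is the deviation
    matrix, with A_i = y_i y_i^T - D.

    The hypothesis on r gives |y_i|^2 <= L almost surely, with L of order
    c_R^2 N / (log N)^2, and the operator norm of W is controlled by the trace
    moments m_p = E[tr W^(2p)] with p of order log N. The moments are bounded by
    induction on p. Let Y_i = W - A_i, which is independent of A_i, so that
    E[tr(A_i Y_i^q)] = 0. Then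
      m_(p+1) = sum_i E[tr(A_i W^(2p+1))]
              = sum_i E[tr(A_i (W^(2p+1) - Y_i^(2p+1)))],
    and expanding the difference of powers leaves words
    tr(A W^q A Y^(2p-q)). For even q these are squared norms which are convex
    in q, so every word is at most tr(A^2 W^(2p)) + tr(A^2 Y^(2p))
    (trace_word_le). As A_i^2 is at most 2 L (y_i y_i^T + D) = 2 L (A_i + 2 D), the
    sum over i reproduces W itself; the same convexity yields the Jensen inequality
    E[tr Y_i^(2p)] <= m_p. This gives m_(p+1) <= 20 L N (2p+1) m_p as long as
    L (2p+1) <= N (trace_moment_le), and Markov's inequality for p about
    log_2 N concludes (deviation_concentration): since m_1 <= 4 N L^2 does not
    depend on k, neither does the final bound.

    Independence enters only through E[tr(A_i Y_i^q)] = 0. It follows from the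
    product rule E[prod_j g_j(X_j)] = prod_j E[g_j(X_j)] for bounded measurable
    g_j (Ex_prod_indep), as the entries of Y_i^q are sums of such products over
    the indices j != i. *)

Set Implicit Arguments.
Unset Strict Implicit.
Unset Printing Implicit Defensive.

(** * Frobenius inner product, convexity and traces of words *)

(** The core of the Cauchy-Schwarz inequality, shared by the Frobenius product of
    matrices and by the inner product of the Hilbert space. *)
Lemma discriminant_le (R : realFieldType) (a b c : R) :
  (forall s t, 0 <= s ^+ 2 * a + s * t * 2 * b + t ^+ 2 * c) -> b ^+ 2 <= a * c.
Proof.
move=> quad; have c_ge0 : 0 <= c by have := quad 0 1; lra.
have [c0|c_gt0] : c = 0 \/ 0 < c.
  by move: c_ge0; rewrite le_eqVlt => /orP[/eqP <-|]; [left|right].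
(* The form is then affine in t, which forces b to vanish. *)
- by have := quad (- b) ((a + 1) / 2); rewrite c0; nra.
- by rewrite -subr_ge0 -(pmulr_rge0 _ c_gt0); have := quad c (- b); nra.
Qed.

Section Frobenius.
Variable R : realFieldType.

Definition frob {m n} (A B : 'M[R]_(m, n)) : R := \tr (A^T *m B).

Lemma frobE m n (A B : 'M[R]_(m, n)) :
  frob A B = \sum_i \sum_j A i j * B i j.
Proof.
rewrite /frob /mxtrace exchange_big /=; apply: eq_bigr => j _.
by rewrite mxE; apply: eq_bigr => i _; rewrite mxE.
Qed.

Lemma frob_ge0 m n (A : 'M[R]_(m, n)) : 0 <= frob A A.
Proof.
rewrite frobE; apply: sumr_ge0 => i _; apply: sumr_ge0 => j _.
exact: sqr_ge0.
Qed.

Lemma frobC m n (A B : 'M[R]_(m, n)) : frob A B = frob B A.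
Proof. by rewrite /frob -mxtrace_tr trmx_mul trmxK. Qed.

Lemma frobDl m n (A B C : 'M[R]_(m, n)) : frob (A + B) C = frob A C + frob B C.
Proof. by rewrite /frob linearD mulmxDl mxtraceD. Qed.

Lemma frobZl m n a (A C : 'M[R]_(m, n)) : frob (a *: A) C = a * frob A C.
Proof. by rewrite /frob linearZ /= -scalemxAl mxtraceZ. Qed.

Lemma frob_quad m n a b (A B : 'M[R]_(m, n)) :
  frob (a *: A + b *: B) (a *: A + b *: B) =
  a ^+ 2 * frob A A + a * b * 2 * frob A B + b ^+ 2 * frob B B.
Proof.
rewrite frobDl !frobZl ![frob _ (_ + _)]frobC !frobDl !frobZl [frob B A]frobC.
ring.
Qed.

Lemma frob_amgm m n (A B : 'M[R]_(m, n)) :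
  2 * frob A B <= frob A A + frob B B.
Proof. have := frob_ge0 (1 *: A + (-1) *: B); rewrite frob_quad; lra. Qed.

Lemma frob_sub_le m n (A B : 'M[R]_(m, n)) :
  frob (A - B) (A - B) <= 2 * frob A A + 2 * frob B B.
Proof.
have := frob_ge0 (1 *: A + 1 *: B).
have -> : A - B = 1 *: A + (-1) *: B by rewrite scale1r scaleN1r.
by rewrite !frob_quad; lra.
Qed.

Lemma frob_outer m n (y : 'cV[R]_m) (v : 'rV[R]_n) :
  frob (y *m v) (y *m v) = frob y y * frob v v.
Proof.
rewrite !frobE mulr_suml; apply: eq_bigr => i _.
rewrite !big_ord1 mulr_sumr; apply: eq_bigr => j _.
by rewrite !mxE !big_ord1; ring.
Qed.

Lemma frob_mulmx_le m n (A : 'M[R]_(m, n)) (h : 'cV[R]_n) :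
  frob (A *m h) (A *m h) <= frob A A * frob h h.
Proof.
suff row_le i : (A *m h) i 0 ^+ 2 <= (\sum_j A i j ^+ 2) * frob h h.
  rewrite [X in X <= _]frobE [frob A A]frobE mulr_suml.
  by apply: ler_sum => i _; rewrite big_ord1 -expr2; exact: row_le.
pose v := \row_j A i j.
have vE : \sum_j A i j ^+ 2 = frob v v.
  by rewrite frobE big_ord1; apply: eq_bigr => j _; rewrite !mxE expr2.
have vhE : (A *m h) i 0 = frob v h^T.
  by rewrite frobE big_ord1 mxE; apply: eq_bigr => j _; rewrite !mxE.
have hE : frob h h = frob h^T h^T.
  by rewrite /frob trmxK mxtrace_mulC.
rewrite vE vhE hE.
apply: discriminant_le => s t; rewrite -frob_quad; exact: frob_ge0.
Qed.

End Frobenius.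

Section Convex.
Variable R : realFieldType.

(** Midpoint convexity first compares a_i with the chord from 0 to i + 1; these
    short chords are then lengthened one step at a time. *)
Lemma convex_seq_chord (a : nat -> R) n :
  (forall i, (i.+2 <= n)%N -> 2 * a i.+1 <= a i + a i.+2) ->
  forall i, (i <= n)%N -> n%:R * a i <= (n - i)%:R * a 0%N + i%:R * a n.
Proof.
move=> cvx.
have step i : (i < n)%N -> i.+1%:R * a i <= a 0%N + i%:R * a i.+1.
  elim: i => [|i IH] lt_in; first by rewrite mul1r mul0r addr0.
  have := IH (ltnW lt_in); have := cvx i lt_in.
  rewrite -!natr1 => c2 c1.
  have i0 : 0 <= i%:R :> R by rewrite ler0n.
  have := ler_wpM2l (addr_ge0 i0 ler01) c2; lra.
elim: n {cvx} step => [|n IH] step i le_in.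
  by move: le_in; rewrite leqn0 => /eqP ->; rewrite !mul0r addr0.
move: le_in; rewrite leq_eqVlt => /predU1P[->|lt_in].
  by rewrite subnn mul0r add0r.
have [n0|n_gt0] := posnP n.
  by move: lt_in; rewrite n0 ltnS leqn0 => /eqP ->; rewrite subn0 mul0r addr0.
have := IH (fun j lt_j => step j (ltnW lt_j)) i lt_in.
have := step n (ltnSn n).
rewrite subSn // -!natr1 natrB //.
have i0 : 0 <= i%:R :> R by rewrite ler0n.
have n0 : 0 < n%:R :> R by rewrite ltr0n.
move=> h1 h2.
rewrite -(ler_pM2l n0).
have := ler_wpM2l i0 h1; have := ler_wpM2l (addr_ge0 (ltW n0) ler01) h2; lra.
Qed.

End Convex.

Section TraceInequalities.
Variables (R : realFieldType) (k : nat).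
Implicit Types A X Y Z : 'M[R]_k.

Definition symmx A := A^T = A.

Lemma symmxX A n : symmx A -> symmx (A ^+ n).
Proof.
move=> sA; elim: n => [|n IH]; first by rewrite /symmx expr0 trmx1.
by rewrite /symmx exprS -mulmxE trmx_mul IH sA mulmxE -exprSr exprS.
Qed.

Lemma frob_word A X Y i j i' j' : symmx A -> symmx X -> symmx Y ->
  frob (X ^+ i * A * Y ^+ j) (X ^+ i' * A * Y ^+ j') =
  \tr (A * X ^+ (i + i') * A * Y ^+ (j + j')).
Proof.
move=> sA sX sY; rewrite /frob -!mulmxE !trmx_mul sA !symmxX // !mulmxE.
rewrite [(j + j')%N]addnC !exprD !mulrA -[LHS]mxtrace_mulC.
have := mxtrace_mulC (Y ^+ j' * Y ^+ j) (A * X ^+ i * X ^+ i' * A).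
by rewrite !mulmxE !mulrA.
Qed.

(** The sequence a_i = |X^i A Y^(n-i)|^2 is convex in i, because a_(i+1) is the
    inner product of the matrices whose squared norms are a_i and a_(i+2): left
    multiplication by X commutes with right multiplication by Y. *)
Lemma word_norms_convex A X Y n : symmx A -> symmx X -> symmx Y ->
  forall i, (i <= n)%N ->
  n%:R * \tr (A * X ^+ i.*2 * A * Y ^+ (n - i).*2) <=
  (n - i)%:R * \tr (A * A * Y ^+ n.*2) + i%:R * \tr (A * A * X ^+ n.*2).
Proof.
move=> sA sX sY i le_in.
pose a i := \tr (A * X ^+ i.*2 * A * Y ^+ (n - i).*2).
have aE j : a j = frob (X ^+ j * A * Y ^+ (n - j)) (X ^+ j * A * Y ^+ (n - j)).
  by rewrite frob_word // !addnn.
have := @convex_seq_chord R a n _ i.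
rewrite /a subn0 subnn expr0 !mulr1.
rewrite -(mxtrace_mulC A) mulmxE mulrA => chord; apply: chord => // j lt_jn.
rewrite -/(a j.+1) -/(a j) -/(a j.+2) (aE j) (aE j.+2).
apply: le_trans; last exact: frob_amgm.
rewrite frob_word // /a.
have -> : (j + j.+2 = j.+1.*2)%N by rewrite -addnn; lia.
have -> // : (n - j + (n - j.+2) = (n - j.+1).*2)%N.
by rewrite -addnn; lia.
Qed.

(** A word of even degree q = 2i is one of the squared norms of
    word_norms_convex, hence is at most the sum of the two extreme ones; a word
    of odd degree is an inner product of two neighbours. This replaces the
    inequality between geometric and arithmetic means that one would read off
    from the spectral decompositions of X and Y. *)
Lemma trace_word_le A X Y n q : (0 < n)%N -> symmx A -> symmx X -> symmx Y ->
  (q <= n.*2)%N ->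
  \tr (A * X ^+ q * A * Y ^+ (n.*2 - q)) <=
  \tr (A * A * X ^+ n.*2) + \tr (A * A * Y ^+ n.*2).
Proof.
move=> n_gt0 sA sX sY le_qn.
pose a i := \tr (A * X ^+ i.*2 * A * Y ^+ (n - i).*2).
have aE j : a j = frob (X ^+ j * A * Y ^+ (n - j)) (X ^+ j * A * Y ^+ (n - j)).
  by rewrite frob_word // !addnn.
have a_le j : (j <= n)%N -> a j <= a n + a 0%N.
  move=> le_jn; have := word_norms_convex sA sX sY le_jn.
  rewrite -/(a j).
  have -> : \tr (A * A * X ^+ n.*2) = a n.
    by rewrite /a subnn expr0 mulr1 -(mxtrace_mulC A) mulmxE mulrA.
  have -> : \tr (A * A * Y ^+ n.*2) = a 0%N.
    by rewrite /a subn0 expr0 mulr1.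
  have a0_ge0 : 0 <= a 0%N by rewrite aE frob_ge0.
  have an_ge0 : 0 <= a n by rewrite aE frob_ge0.
  rewrite natrB // => le_aj; rewrite -(@ler_pM2l _ n%:R) ?ltr0n //.
  have jn : j%:R <= n%:R :> R by rewrite ler_nat.
  have j0 : 0 <= j%:R :> R by rewrite ler0n.
  by apply: le_trans le_aj _; nra.
have -> : \tr (A * A * X ^+ n.*2) = a n.
  by rewrite /a subnn expr0 mulr1 -(mxtrace_mulC A) mulmxE mulrA.
have -> : \tr (A * A * Y ^+ n.*2) = a 0%N by rewrite /a subn0 expr0 mulr1.
pose i := q./2; pose i' := (q - q./2)%N.
have le_in : (i <= n)%N by rewrite /i; lia.
have le_in' : (i' <= n)%N by rewrite /i'; lia.
have qE : q = (i + i')%N by rewrite /i /i'; lia.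
have := frob_amgm (X ^+ i * A * Y ^+ (n - i)) (X ^+ i' * A * Y ^+ (n - i')).
rewrite -!aE frob_word // -qE.
have -> : ((n - i) + (n - i') = n.*2 - q)%N by rewrite -addnn; lia.
have := a_le _ le_in; have := a_le _ le_in'; lra.
Qed.

Lemma subrXX_left X Y n :
  X ^+ n.+1 - Y ^+ n.+1 = \sum_(q < n.+1) X ^+ q * (X - Y) * Y ^+ (n - q).
Proof.
elim: n => [|n IH]; first by rewrite big_ord1 !expr1 expr0 mul1r mulr1.
rewrite big_ord_recl expr0 mul1r subn0 /=.
transitivity ((X - Y) * Y ^+ n.+1 + X * (X ^+ n.+1 - Y ^+ n.+1)).
  by rewrite mulrBl mulrBr -!exprS [RHS]addrC addrA subrK.
rewrite IH mulr_sumr; congr (_ + _); apply: eq_bigr => q _.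
by rewrite /bump add1n subSS exprS !mulrA.
Qed.

Lemma trace_odd_power_diff X Y n : (0 < n)%N -> symmx X -> symmx Y ->
  \tr ((X - Y) * X ^+ n.*2.+1) - \tr ((X - Y) * Y ^+ n.*2.+1) <=
  n.*2.+1%:R * (\tr ((X - Y) * (X - Y) * X ^+ n.*2) +
                \tr ((X - Y) * (X - Y) * Y ^+ n.*2)).
Proof.
move=> n_gt0 sX sY.
have sA : symmx (X - Y) by rewrite /symmx linearB /= sX sY.
rewrite -raddfB -mulrBr subrXX_left mulr_sumr raddf_sum /= mulr_natl.
rewrite -[X in _ *+ X]card_ord -sumr_const; apply: ler_sum => q _.
by rewrite !mulrA; apply: trace_word_le => //; rewrite -ltnS.
Qed.

(** The case A = 1 of word_norms_convex: the chord at i = 1, together with the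
    arithmetic mean bound on the word of degree one in X, yields the tangent of
    tr X^(2n+2) at Y. *)
Lemma trace_even_power_tangent X Y n : symmx X -> symmx Y ->
  \tr (Y ^+ n.+1.*2) + n.+1.*2%:R * \tr ((X - Y) * Y ^+ n.*2.+1) <=
  \tr (X ^+ n.+1.*2).
Proof.
move=> sX sY.
have s1 : symmx (1 : 'M[R]_k) by rewrite /symmx trmx1.
have := @word_norms_convex 1 X Y n.+1 s1 sX sY 1%N isT.
rewrite !mul1r !mulr1 subn1 /= => cvx.
have := frob_amgm (X ^+ 0 * 1 * Y ^+ n.+1) (X ^+ 1 * 1 * Y ^+ n).
rewrite !frob_word // !mul1r !mulr1 !add0n ?expr0 ?mul1r ?mulr1.
have -> : (n.+1 + n = n.*2.+1)%N by rewrite -addnn; lia.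
rewrite addnn addnn.
have -> : \tr (X ^+ 1 * Y ^+ n.*2.+1) =
    \tr (Y ^+ n.+1.*2) + \tr ((X - Y) * Y ^+ n.*2.+1).
  by rewrite expr1 mulrBl linearB /= -exprS -doubleS addrC subrK.
move: cvx; rewrite -[n.+1%:R]natr1.
have -> : n.+1.*2%:R = 2 * (n%:R + 1) :> R by rewrite -mul2n natrM natr1.
rewrite addnn; set t2 := \tr (X ^+ _ * Y ^+ n.*2).
have n0 : 0 <= n%:R :> R by rewrite ler0n.
move=> h1 h2.
have := ler_wpM2l (addr_ge0 n0 ler01) h2; lra.
Qed.

Lemma frob_symmx_pow X n : symmx X -> frob (X ^+ n) (X ^+ n) = \tr (X ^+ n.*2).
Proof. by move=> sX; rewrite /frob symmxX // mulmxE -exprD addnn. Qed.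

Lemma trace_even_power_ge0 X n : symmx X -> 0 <= \tr (X ^+ n.*2).
Proof. by move=> sX; rewrite -frob_symmx_pow // frob_ge0. Qed.

(** Weighted arithmetic-geometric mean inequality for the inner product of
    X^(n+1) and X^n; the free weight a balances the two even moments. *)
Lemma trace_odd_power_le X n a : symmx X ->
  2 * a * \tr (X ^+ n.*2.+1) <=
  \tr (X ^+ n.+1.*2) + a ^+ 2 * \tr (X ^+ n.*2).
Proof.
move=> sX.
have := frob_ge0 (1 *: X ^+ n.+1 + (- a) *: X ^+ n).
rewrite frob_quad !frob_symmx_pow // /frob symmxX // mulmxE -exprD.
have -> : (n.+1 + n = n.*2.+1)%N by rewrite -addnn; lia.
lra.
Qed.

(** With s_i = |X^i h|^2, positivity of |X^(i+2) h - t^2 X^i h|^2 shows that a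
    ratio s_(i+1) / s_i exceeding t^2 propagates to all later i. It would give
    s_n > t^(2n) s_0, which the trace forbids; hence |X h| <= t |h|. *)
Lemma quad_form_le X n (t : R) (h : 'cV[R]_k) : symmx X -> 0 < t ->
  (0 < n)%N -> \tr (X ^+ n.*2) <= t ^+ n.*2 ->
  `|frob h (X *m h)| <= t * frob h h.
Proof.
move=> sX t_gt0 n_gt0 trX.
pose s i := frob (X ^+ i *m h) (X ^+ i *m h).
have s0E : s 0%N = frob h h by rewrite /s expr0 mul1mx.
have s_ge0 i : 0 <= s i by exact: frob_ge0.
have frobM (U V : 'M[R]_k) : symmx U ->
    frob (U *m h) (V *m h) = \tr (h^T *m (U * V) *m h).
  by rewrite /frob trmx_mul => ->; rewrite -mulmxE !mulmxA.
have s_conv i : 2 * t ^+ 2 * s i.+1 <= s i.+2 + t ^+ 4 * s i.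
  have := frob_ge0 (1 *: (X ^+ i.+2 *m h) + (- t ^+ 2) *: (X ^+ i *m h)).
  rewrite frob_quad -/(s i.+2) -/(s i).
  have -> : frob (X ^+ i.+2 *m h) (X ^+ i *m h) = s i.+1.
    by rewrite /s !frobM -?exprD ?addSnnS //; exact: symmxX.
  by lra.
have s1_le : s 1%N <= t ^+ 2 * s 0%N.
  rewrite leNgt; apply/negP => s1_gt.
  have s_gt i : t ^+ 2 * s i < s i.+1.
    elim: i => // i IH; have := s_conv i.
    have := ltr_pM2l (exprn_gt0 2 t_gt0) (t ^+ 2 * s i) (s i.+1).
    by rewrite IH => /idP; lra.
  have sn_gt i : t ^+ i.+1.*2 * s 0%N < s i.+1.
    elim: i => // i IH; apply: le_lt_trans (s_gt i.+1).
    rewrite doubleS exprS exprS mulrA -expr2 -mulrA.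
    by rewrite ler_pM2l ?exprn_gt0 // ltW.
  case: n n_gt0 trX => // n _ trX.
  have := sn_gt n; apply/negP; rewrite -leNgt.
  apply: le_trans (frob_mulmx_le _ _) _.
  by rewrite frob_symmx_pow // s0E ler_wpM2r ?frob_ge0.
have quad a := frob_ge0 (a *: h + 1 *: (X *m h)).
have s1E : s 1%N = frob (X *m h) (X *m h) by rewrite /s expr1.
have := quad t; have := quad (- t); rewrite !frob_quad -s1E -s0E.
rewrite ler_norml => h1 h2.
by apply/andP; split; rewrite -(ler_pM2l t_gt0); lra.
Qed.

End TraceInequalities.

Section RankOne.
Variables (R : realFieldType) (k : nat).
Variables (y : 'cV[R]_k) (d : 'rV[R]_k) (L : R).

Let D := diag_mx d.
Let A : 'M[R]_k := y *m y^T - D.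

Lemma symmx_centered : symmx A.
Proof.
by rewrite /symmx /A linearB /= trmx_mul trmxK tr_diag_mx.
Qed.

Lemma trace_diag_gram m (Z : 'M[R]_(k, m)) :
  \tr (D *m (Z *m Z^T)) = \sum_i \sum_j d 0 i * Z i j ^+ 2.
Proof.
apply: eq_bigr => i _; rewrite /D mul_diag_mx !mxE mulr_sumr.
by apply: eq_bigr => j _; rewrite !mxE expr2.
Qed.

Hypothesis d_ge0 : forall j, 0 <= d 0 j.

Lemma trace_diag_gram_le m (Z : 'M[R]_(k, m)) : (forall j, d 0 j <= 1) ->
  \tr (D *m (Z *m Z^T)) <= \tr (Z *m Z^T).
Proof.
move=> d_le1; rewrite trace_diag_gram mxtrace_mulC -/(frob Z Z) frobE.
apply: ler_sum => i _; apply: ler_sum => j _.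
by rewrite -expr2 ler_piMl ?sqr_ge0.
Qed.

(** Here (y y^T)^2 <= L y y^T and D^2 <= L D, so that A^2 <= 2 L (y y^T + D).
    Writing y y^T = A + D makes the bound affine in A, whose mean is zero. *)
Lemma trace_centered_sqr_le m (Z : 'M[R]_(k, m)) :
  frob y y <= L -> (forall j, d 0 j <= L) ->
  \tr (A *m A *m (Z *m Z^T)) <=
  2 * L * (\tr (A *m (Z *m Z^T)) + 2 * \tr (D *m (Z *m Z^T))).
Proof.
move=> y_le d_le.
have -> : \tr (A *m A *m (Z *m Z^T)) = frob (A *m Z) (A *m Z).
  rewrite /frob trmx_mul symmx_centered [RHS]mxtrace_mulC.
  by rewrite -(mulmxA A A) [LHS]mxtrace_mulC !mulmxA.
have -> : A *m Z = y *m (y^T *m Z) - D *m Z by rewrite mulmxBl mulmxA.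
apply: le_trans (frob_sub_le _ _) _; rewrite frob_outer.
have -> : \tr (A *m (Z *m Z^T)) =
    frob (y^T *m Z) (y^T *m Z) - \tr (D *m (Z *m Z^T)).
  rewrite mulmxBl linearB /=; congr (_ - _).
  rewrite /frob trmx_mul trmxK [RHS]mxtrace_mulC.
  by rewrite -(mulmxA y) [LHS]mxtrace_mulC !mulmxA.
have DZ_le : frob (D *m Z) (D *m Z) <= L * \tr (D *m (Z *m Z^T)).
  rewrite trace_diag_gram frobE mulr_sumr; apply: ler_sum => i _.
  rewrite mulr_sumr; apply: ler_sum => j _.
  rewrite mul_diag_mx mxE -expr2 exprMn mulrA.
  by rewrite ler_wpM2r ?sqr_ge0 // expr2 ler_wpM2r.
have := ler_wpM2r (frob_ge0 (y^T *m Z)) y_le; lra.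
Qed.

End RankOne.

Lemma frob_centered {R : realFieldType} k (y h : 'cV[R]_k) (d : 'rV[R]_k) :
  frob h ((y *m y^T - diag_mx d) *m h) =
  (\sum_j h j 0 * y j 0) ^+ 2 - \sum_j d 0 j * h j 0 ^+ 2.
Proof.
rewrite frobE expr2 mulr_suml -sumrB; apply: eq_bigr => i _.
rewrite big_ord1 mulmxBl -mulmxA mul_diag_mx !mxE big_ord1 !mxE.
have -> : \sum_j y^T 0 j * h j 0 = \sum_j h j 0 * y j 0.
  by apply: eq_bigr => j _; rewrite mxE mulrC.
ring.
Qed.

(** * Bounded measurable functions and their means *)

Section BoundedMeasurable.
Context {dT : measure_display} {T : measurableType dT} {R : realType}.
Implicit Types f g : T -> R.

(** Boundedness makes all the means below finite and stable under products. *)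
Definition bmeas f := measurable_fun setT f /\ exists B : R, forall x, `|f x| <= B.

Lemma bmeas_cst (a : R) : bmeas (fun=> a).
Proof. by split; [exact: measurable_cst | exists `|a|]. Qed.

Lemma bmeasD f g : bmeas f -> bmeas g -> bmeas (fun x => f x + g x).
Proof.
move=> [mf [B fB]] [mg [C gC]]; split; first exact: measurable_funD.
exists (B + C) => x; apply: le_trans (ler_normD _ _) _.
exact: lerD.
Qed.

Lemma bmeasM f g : bmeas f -> bmeas g -> bmeas (fun x => f x * g x).
Proof.
move=> [mf [B fB]] [mg [C gC]]; split; first exact: measurable_funM.
by exists (B * C) => x; rewrite normrM ler_pM.
Qed.

Lemma bmeasZ a f : bmeas f -> bmeas (fun x => a * f x).
Proof. by apply: bmeasM; exact: bmeas_cst. Qed.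

Lemma bmeasN f : bmeas f -> bmeas (fun x => - f x).
Proof.
move=> bf; have := bmeasZ (-1) bf.
by congr bmeas; apply/funext => x; rewrite mulN1r.
Qed.

Lemma bmeasB f g : bmeas f -> bmeas g -> bmeas (fun x => f x - g x).
Proof. by move=> bf bg; apply: bmeasD => //; exact: bmeasN. Qed.

Lemma bmeas_sum (I : Type) (r : seq I) (Q : pred I) (F : I -> T -> R) :
  (forall i, Q i -> bmeas (F i)) -> bmeas (fun x => \sum_(i <- r | Q i) F i x).
Proof.
move=> bF; elim: r => [|i r IH].
  rewrite (_ : (fun x => _) = fun=> 0); first exact: bmeas_cst.
  by apply/funext => x; rewrite big_nil.
have [Qi|nQi] := boolP (Q i).
  rewrite (_ : (fun x => _) =
    fun x => F i x + \sum_(j <- r | Q j) F j x).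
    by apply: bmeasD => //; exact: bF.
  by apply/funext => x; rewrite big_cons Qi.
by move: IH; congr bmeas; apply/funext => x; rewrite big_cons (negbTE nQi).
Qed.

Lemma bmeas_prod (I : Type) (r : seq I) (Q : pred I) (F : I -> T -> R) :
  (forall i, Q i -> bmeas (F i)) -> bmeas (fun x => \prod_(i <- r | Q i) F i x).
Proof.
move=> bF; elim: r => [|i r IH].
  rewrite (_ : (fun x => _) = fun=> 1); first exact: bmeas_cst.
  by apply/funext => x; rewrite big_nil.
have [Qi|nQi] := boolP (Q i).
  rewrite (_ : (fun x => _) =
    fun x => F i x * \prod_(j <- r | Q j) F j x).
    by apply: bmeasM => //; exact: bF.
  by apply/funext => x; rewrite big_cons Qi.
by move: IH; congr bmeas; apply/funext => x; rewrite big_cons (negbTE nQi).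
Qed.

Lemma bmeas_indic (A : set T) : measurable A -> bmeas (\1_A : T -> R).
Proof.
move=> mA; split; first exact: measurable_indic.
by exists 1 => x; rewrite indicE; case: (_ \in _); rewrite ?normr1 ?normr0.
Qed.

Variable P : probability T R.

Lemma bmeas_integrable f : bmeas f -> P.-integrable setT (EFin \o f).
Proof.
move=> [mf [B fB]]; apply: measurable_bounded_integrable => //.
  by rewrite ltey_eq fin_num_measure.
exists B; split; first exact: num_real.
by move=> c Bc x _ /=; exact: le_trans (fB x) (ltW Bc).
Qed.

(** The real-valued mean, so that no side condition on infinite values occurs
    for the functions of bmeas. *)
Definition Ex f : R := \int[P]_x f x.

Lemma ExD f g : bmeas f -> bmeas g -> Ex (fun x => f x + g x) = Ex f + Ex g.
Proof. by move=> bf bg; rewrite /Ex RintegralD //; exact: bmeas_integrable. Qed.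

Lemma ExB f g : bmeas f -> bmeas g -> Ex (fun x => f x - g x) = Ex f - Ex g.
Proof. by move=> bf bg; rewrite /Ex RintegralB //; exact: bmeas_integrable. Qed.

Lemma ExZ a f : bmeas f -> Ex (fun x => a * f x) = a * Ex f.
Proof. by move=> bf; rewrite /Ex RintegralZl //; exact: bmeas_integrable. Qed.

Lemma Ex_cst a : Ex (fun=> a) = a.
Proof.
rewrite /Ex Rintegral_cst //; set p := fine _.
have -> : p = 1 by exact: (congr1 fine (probability_setT P)).
by rewrite mulr1.
Qed.

Lemma Ex_sum (I : Type) (r : seq I) (Q : pred I) (F : I -> T -> R) :
  (forall i, Q i -> bmeas (F i)) ->
  Ex (fun x => \sum_(i <- r | Q i) F i x) = \sum_(i <- r | Q i) Ex (F i).
Proof.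
move=> bF; elim: r => [|i r IH].
  rewrite big_nil -[RHS]Ex_cst; congr Ex.
  by apply/funext => x; rewrite big_nil.
rewrite big_cons; case: ifP => Qi.
  rewrite -IH -ExD; [|exact: bF|exact: bmeas_sum].
  by congr Ex; apply/funext => x; rewrite big_cons Qi.
by rewrite -IH; congr Ex; apply/funext => x; rewrite big_cons Qi.
Qed.

Lemma Ex_indic (A : set T) : measurable A -> Ex \1_A = fine (P A).
Proof. by move=> mA; rewrite /Ex /Rintegral integral_indic // setIT. Qed.

Lemma le_Ex_ae f g : bmeas f -> bmeas g -> {ae P, forall x, f x <= g x} ->
  Ex f <= Ex g.
Proof.
move=> bf bg fg; rewrite -subr_ge0 -ExB //.
have bh := bmeasB bg bf.
suff -> : Ex (fun x => g x - f x) = Ex (fun x => `|g x - f x|).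
  by rewrite /Ex Rintegral_ge0.
rewrite /Ex /Rintegral; congr fine; apply: ae_eq_integral => //.
- by apply/measurable_EFinP; case: bh.
- by apply/measurable_EFinP; apply: measurableT_comp => //; case: bh.
- by apply: filterS fg => x fg _; rewrite ger0_norm // subr_ge0.
Qed.

Lemma le_Ex f g : bmeas f -> bmeas g -> (forall x, f x <= g x) -> Ex f <= Ex g.
Proof. by move=> bf bg fg; apply: le_Ex_ae => //; exact: aeW. Qed.

Lemma Ex_norm_le f B : bmeas f -> (forall x, `|f x| <= B) -> `|Ex f| <= B.
Proof.
move=> bf fB; rewrite ler_norml.
apply/andP; split.
  rewrite -(Ex_cst (- B)) le_Ex //; first exact: bmeas_cst.
  by move=> x; have := fB x; rewrite ler_norml => /andP[].
rewrite -(Ex_cst B) le_Ex //; first exact: bmeas_cst.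
by move=> x; have := fB x; rewrite ler_norml => /andP[].
Qed.

Lemma Ex_markov f (a : R) : bmeas f -> (forall x, 0 <= f x) -> 0 < a ->
  (((1 - Ex f / a)%R)%:E <= P [set x | (f x <= a)%R])%E.
Proof.
move=> bf f_ge0 a_gt0.
have mA : measurable [set x | a < f x].
  have -> : [set x | a < f x] = f @^-1` `]a, +oo[.
    by apply/seteqP; split=> x /=; rewrite in_itv /= andbT.
  by rewrite -[X in measurable X]setTI; apply: bf.1 => //; exact: measurable_itv.
have -> : [set x | f x <= a] = ~` [set x | a < f x].
  by apply/seteqP; split=> x /=; rewrite leNgt => /negP.
rewrite probability_setC // -(@fineK _ (P [set x | a < f x])); last first.
  exact: fin_num_measure.
rewrite -EFinB lee_fin lerD2l lerN2 -Ex_indic // ler_pdivlMr // mulrC -ExZ.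
  apply: le_Ex => //; first by apply: bmeasZ; exact: bmeas_indic.
  move=> x; rewrite indicE; case: (boolP (x \in _)); last by rewrite mulr0.
  by rewrite inE /= mulr1 => /ltW.
exact: bmeas_indic.
Qed.

Lemma measurable_sublevel f (a : R) : bmeas f -> measurable [set x | f x <= a].
Proof.
move=> bf; have -> : [set x | f x <= a] = f @^-1` `]-oo, a].
  by apply/seteqP; split=> x /=; rewrite in_itv.
by rewrite -[X in measurable X]setTI; apply: bf.1 => //; exact: measurable_itv.
Qed.

End BoundedMeasurable.

Lemma bmeas_comp {dS dT : measure_display} {S : measurableType dS}
    {T : measurableType dT} {R : realType} (f : T -> R) (X : S -> T) :
  bmeas f -> measurable_fun setT X -> bmeas (fun s => f (X s)).
Proof.
by move=> [mf [B fB]] mX; split; [exact: measurableT_comp | exists B].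
Qed.

Section Halving.
Context {dT : measure_display} {T : measurableType dT} {R : realType}.

(** Any g with values in [0, 1] is half an indicator plus half of another such
    function, so that a linear functional vanishing on indicators satisfies
    |Phi g| = |Phi g'| / 2 and, being bounded, is zero. *)
Lemma bmeas_linear_eq0 (Phi : (T -> R) -> R) C :
  (forall f g, bmeas f -> bmeas g ->
     Phi (fun x => f x + g x) = Phi f + Phi g) ->
  (forall a f, bmeas f -> Phi (fun x => a * f x) = a * Phi f) ->
  (forall f, bmeas f -> (forall x, 0 <= f x <= 1) -> `|Phi f| <= C) ->
  (forall A, measurable A -> Phi \1_A = 0) ->
  forall f, bmeas f -> Phi f = 0.
Proof.
move=> PhiD PhiZ PhiC Phi1.
have half f : bmeas f -> (forall x, 0 <= f x <= 1) -> Phi f = 0.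
  move=> bf f01.
  suff Phi_le n (g : T -> R) : bmeas g -> (forall x, 0 <= g x <= 1) ->
      2 ^+ n * `|Phi g| <= C.
    apply/eqP; rewrite -normr_le0 leNgt; apply/negP => Phi_gt0.
    have := Phi_le (Num.truncn (C / `|Phi f|)).+1 f bf f01; apply/negP.
    rewrite -ltNge -ltr_pdivrMr //.
    apply: lt_trans (truncnS_gt _) _.
    by rewrite -natrX ltr_nat ltn_expl.
  elim: n g => [|n IH] g bg g01; first by rewrite mul1r; exact: PhiC.
  pose A := [set x | g x <= 2^-1].
  have mA : measurable (~` A) by apply: measurableC; exact: measurable_sublevel.
  pose g' x := 2 * g x - \1_(~` A) x.
  have bg' : bmeas g'.
    by apply: bmeasB; [exact: bmeasZ|exact: bmeas_indic].
  have g'01 x : 0 <= g' x <= 1.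
    rewrite /g' indicE; have := g01 x; rewrite in_setC /A.
    case: (boolP (x \in _)) => /=; rewrite ?inE ?notin_setE /=; first lra.
    by move=> /negP; rewrite -ltNge; lra.
  have gE : g = (fun x => 2^-1 * \1_(~` A) x + 2^-1 * g' x).
    by apply/funext => x; rewrite /g'; field.
  have PhiE : Phi g = 2^-1 * Phi g'.
    have bA := bmeas_indic (R := R) mA.
    rewrite [X in Phi X = _]gE (PhiD _ _ (bmeasZ _ bA) (bmeasZ _ bg')).
    by rewrite !PhiZ // Phi1 // mulr0 add0r.
  have := IH g' bg' g'01.
  rewrite PhiE normrM (@ger0_norm _ 2^-1) ?invr_ge0 // exprSr.
  by rewrite -mulrA (mulrA 2) mulfV // mul1r.
move=> f bf; have [_ [B fB]] := bf.
have B_ge0 : 0 <= B by apply: le_trans (fB point).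
(* an affine change of variable brings f into [0, 1] *)
pose c := 2 * B + 1.
have c_gt0 : 0 < c by rewrite /c; lra.
pose h x := c^-1 * (f x + B).
have bh : bmeas h by apply: bmeasZ; apply: bmeasD => //; exact: bmeas_cst.
have h01 x : 0 <= h x <= 1.
  have := fB x; rewrite ler_norml /h => /andP[h1 h2].
  rewrite mulr_ge0 ?invr_ge0 ?(ltW c_gt0) //=; last lra.
  by rewrite mulrC ler_pdivrMr // mul1r /c; lra.
have fE : f = (fun x => c * h x + (- B) * \1_setT x).
  apply/funext => x; rewrite /h indicE in_setT mulr1 mulrA mulfV ?gt_eqF //.
  by rewrite mul1r addrK.
have bT : bmeas (\1_setT : T -> R) by exact: bmeas_indic.
rewrite fE (PhiD _ _ (bmeasZ _ bh) (bmeasZ _ bT)) (PhiZ _ _ bh) (PhiZ _ _ bT).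
by rewrite Phi1 // half // !mulr0 addr0.
Qed.

End Halving.

(** * Product rule for independent variables *)

Section Independence.
Context {dS dT : measure_display} {S : measurableType dS}
  {T : measurableType dT} {R : realType}.
Variables (P : probability S R) (N : nat) (X : 'I_N -> S -> T).
Hypothesis mX : forall i, measurable_fun setT (X i).
Hypothesis indep : forall A : 'I_N -> set T, (forall i, measurable (A i)) ->
  Ex P (fun w => \prod_i \1_(A i) (X i w)) =
  \prod_i Ex P (fun w => \1_(A i) (X i w)).

Lemma bmeasX i (f : T -> R) : bmeas f -> bmeas (fun w => f (X i w)).
Proof. by move=> bf; exact: bmeas_comp. Qed.

(** The indicators are replaced by arbitrary functions one index at a time: with
    all the other factors fixed, the defect of the product rule is a bounded
    linear functional of the remaining factor, and bmeas_linear_eq0 applies. *)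
Lemma Ex_prod_indep (g : 'I_N -> T -> R) : (forall i, bmeas (g i)) ->
  Ex P (fun w => \prod_i g i (X i w)) = \prod_i Ex P (fun w => g i (X i w)).
Proof.
suff claim n (h : 'I_N -> T -> R) : (forall i, bmeas (h i)) ->
    (forall i : 'I_N, (n <= i)%N -> exists2 A, measurable A & h i = \1_A) ->
    Ex P (fun w => \prod_i h i (X i w)) = \prod_i Ex P (fun w => h i (X i w)).
  move=> bg; apply: (claim N) => // i; rewrite leqNgt ltn_ord //.
elim: n h {g} => [|n IH] h bh indic_h.
  have /choice[A hA] : forall i, exists A, measurable A /\ h i = \1_A.
    by move=> i; have [A mA hE] := indic_h i (leq0n i); exists A.
  have -> : h = fun i => \1_(A i) by apply/funext => i; exact: (hA i).2.
  by apply: indep => i; exact: (hA i).1.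
have [lt_nN|le_Nn] := ltnP n N; last first.
  apply: IH => // i le_ni.
  by have := leq_ltn_trans (leq_trans le_Nn le_ni) (ltn_ord i); rewrite ltnn.
pose i0 := Ordinal lt_nN.
pose H w := \prod_(j | j != i0) h j (X j w).
pose c := \prod_(j | j != i0) Ex P (fun w => h j (X j w)).
have bH : bmeas H by apply: bmeas_prod => j _; exact: bmeasX.
pose Phi f := Ex P (fun w => f (X i0 w) * H w) - Ex P (fun w => f (X i0 w)) * c.
have [B HB] := bH.2.
suff : Phi (h i0) = 0.
  move=> /eqP; rewrite subr_eq0 => /eqP PhiE.
  rewrite (bigD1 i0) //= -/c -PhiE; congr Ex; apply/funext => w.
  by rewrite (bigD1 i0).
apply: (@bmeas_linear_eq0 _ _ _ Phi (B + `|c|)) => //.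
- move=> f g bf bg; rewrite /Phi.
  have -> : (fun w => (f (X i0 w) + g (X i0 w)) * H w) =
      fun w => f (X i0 w) * H w + g (X i0 w) * H w.
    by apply/funext => w; rewrite mulrDl.
  rewrite !ExD; [ring| | | |]; try exact: bmeasX.
    by apply: bmeasM => //; exact: bmeasX.
  by apply: bmeasM => //; exact: bmeasX.
- move=> a f bf; rewrite /Phi.
  have -> : (fun w => a * f (X i0 w) * H w) = fun w => a * (f (X i0 w) * H w).
    by apply/funext => w; rewrite mulrA.
  rewrite !ExZ; [ring| |]; first exact: bmeasX.
  by apply: bmeasM => //; exact: bmeasX.
- move=> f bf f01; apply: le_trans (ler_normB _ _) _.
  have f_le w : `|f (X i0 w)| <= 1.
    by have /andP[f0 f1] := f01 (X i0 w); rewrite ger0_norm.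
  apply: lerD.
    apply: Ex_norm_le; first by apply: bmeasM => //; exact: bmeasX.
    by move=> w; rewrite normrM -[B]mul1r ler_pM.
  rewrite normrM -[leRHS]mul1r ler_wpM2r //.
  by apply: Ex_norm_le => //; exact: bmeasX.
- move=> A mA.
  pose h' j := if j == i0 then \1_A : T -> R else h j.
  have h'0 : h' i0 = \1_A by rewrite /h' eqxx.
  have h'n j : j != i0 -> h' j = h j by rewrite /h' => /negbTE ->.
  have bh' j : bmeas (h' j).
    by have [->|/h'n ->] := eqVneq j i0; rewrite ?h'0 //; exact: bmeas_indic.
  have indic_h' (j : 'I_N) : (n <= j)%N -> exists2 A, measurable A & h' j = \1_A.
    move=> le_nj; have [->|ji] := eqVneq j i0; first by exists A; rewrite ?h'0.
    rewrite h'n //; apply: indic_h; rewrite ltn_neqAle le_nj andbT.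
    by apply: contra ji => /eqP nj; apply/eqP/val_inj.
  have := IH h' bh' indic_h'; rewrite [in RHS](bigD1 i0) //= h'0 => E.
  apply/eqP; rewrite subr_eq0; apply/eqP.
  rewrite /c; under eq_bigr => j ji do rewrite -(h'n j ji).
  rewrite -E; congr Ex; apply/funext => w; rewrite (bigD1 i0) //= h'0.
  by congr (_ * _); apply: eq_bigr => j ji; rewrite h'n.
Qed.

Variable i : 'I_N.

(** The algebra generated by the functions of the variables X_j, j <> i. Its
    members are presented as sums of products, the form to which the product
    rule applies. *)
Inductive avoids : (S -> R) -> Prop :=
| avoids_prod a (g : 'I_N -> T -> R) : (forall j, bmeas (g j)) ->
    avoids (fun w => a * \prod_(j | j != i) g j (X j w))
| avoidsD F G : avoids F -> avoids G -> avoids (fun w => F w + G w).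

Lemma bmeas_avoids F : avoids F -> bmeas F.
Proof.
elim=> [a g bg|{}F G _ bF _ bG]; last exact: bmeasD.
by apply: bmeasZ; apply: bmeas_prod => j _; exact: bmeasX.
Qed.

Lemma avoids_cst a : avoids (fun=> a).
Proof.
have := avoids_prod a (fun j => bmeas_cst (1 : R) : bmeas ((fun=> fun=> 1) j : T -> R)).
congr avoids; apply/funext => w; rewrite big1 ?mulr1 //.
Qed.

Lemma avoids_coord j (g : T -> R) : j != i -> bmeas g ->
  avoids (fun w => g (X j w)).
Proof.
move=> ji bg.
have bh l : bmeas ((fun l => if l == j then g else fun=> 1) l : T -> R).
  by case: eqP => // _; exact: bmeas_cst.
have := avoids_prod 1 bh.
congr avoids; apply/funext => w; rewrite mul1r (bigD1 j) //= eqxx.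
by rewrite big1 ?mulr1 // => l /andP[_ /negbTE ->].
Qed.

Lemma avoidsM F G : avoids F -> avoids G -> avoids (fun w => F w * G w).
Proof.
move=> aF aG; elim: aF => [a g bg|F1 F2 _ IH1 _ IH2]; last first.
  have := avoidsD IH1 IH2; congr avoids; apply/funext => w.
  by rewrite mulrDl.
elim: aG => [b h bh|G1 G2 _ IH1 _ IH2]; last first.
  have := avoidsD IH1 IH2; congr avoids; apply/funext => w.
  by rewrite mulrDr.
have := avoids_prod (a * b) (fun j => bmeasM (bg j) (bh j)).
congr avoids; apply/funext => w; rewrite big_split /=.
by rewrite mulrACA.
Qed.

Lemma avoids_sum (I : Type) (r : seq I) (Q : pred I) (F : I -> S -> R) :
  (forall l, Q l -> avoids (F l)) -> avoids (fun w => \sum_(l <- r | Q l) F l w).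
Proof.
move=> aF; elim: r => [|l r IH].
  have := avoids_cst 0; congr avoids; apply/funext => w; by rewrite big_nil.
have [Ql|nQl] := boolP (Q l).
  have := avoidsD (aF l Ql) IH; congr avoids; apply/funext => w.
  by rewrite big_cons Ql.
by move: IH; congr avoids; apply/funext => w; rewrite big_cons (negbTE nQl).
Qed.

Lemma Ex_avoids (f : T -> R) F : bmeas f -> avoids F ->
  Ex P (fun w => f (X i w) * F w) = Ex P (fun w => f (X i w)) * Ex P F.
Proof.
move=> bf; elim=> [a g bg|F1 F2 aF1 IH1 aF2 IH2]; last first.
  have -> : (fun w => f (X i w) * (F1 w + F2 w)) =
      fun w => f (X i w) * F1 w + f (X i w) * F2 w.
    by apply/funext => w; rewrite mulrDr.
  have bfX := bmeasX i bf.
  have b1 := bmeas_avoids aF1; have b2 := bmeas_avoids aF2.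
  rewrite (ExD _ b1 b2) mulrDr -IH1 -IH2 ExD //; exact: bmeasM.
pose h j := if j == i then f else g j.
pose h1 j := if j == i then fun=> 1 : R else g j.
have bh j : bmeas (h j) by rewrite /h; case: eqP.
have bh1 j : bmeas (h1 j).
  by rewrite /h1; case: eqP => // _; exact: bmeas_cst.
have -> : (fun w => f (X i w) * (a * \prod_(j | j != i) g j (X j w))) =
    fun w => a * \prod_j h j (X j w).
  apply/funext => w; rewrite [in RHS](bigD1 i) //= {1}/h eqxx mulrCA.
  congr (_ * (_ * _)); apply: eq_bigr => j /negbTE ji.
  by rewrite /h ji.
have -> : (fun w => a * \prod_(j | j != i) g j (X j w)) =
    fun w => a * \prod_j h1 j (X j w).
  apply/funext => w; rewrite [in RHS](bigD1 i) //= {1}/h1 eqxx mul1r.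
  by congr (_ * _); apply: eq_bigr => j /negbTE ji; rewrite /h1 ji.
rewrite !ExZ; try by apply: bmeas_prod => j _; exact: bmeasX.
rewrite !Ex_prod_indep // mulrCA; congr (_ * _).
rewrite (bigD1 i) //= [in RHS](bigD1 i) //= {1}/h {1}/h1 eqxx Ex_cst mul1r.
by congr (_ * _); apply: eq_bigr => j /negbTE ji; rewrite /h /h1 ji.
Qed.

Variable k : nat.

Definition mx_avoids (F : S -> 'M[R]_k) := forall p q, avoids (fun w => F w p q).

Lemma mx_avoidsX F m : mx_avoids F -> mx_avoids (fun w => F w ^+ m).
Proof.
move=> aF; elim: m => [|m IH] p q.
  have := avoids_cst ((p == q)%:R); congr avoids; apply/funext => w.
  by rewrite expr0 mxE.
have : avoids (fun w => \sum_l F w p l * (F w ^+ m) l q).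
  by apply: avoids_sum => l _; exact: avoidsM.
by congr avoids; apply/funext => w; rewrite exprS !mxE.
Qed.

(** The product rule kills the trace entry by entry. *)
Lemma Ex_trace_avoids (A : T -> 'M[R]_k) F :
  (forall p q, bmeas (fun x => A x p q)) ->
  (forall p q, Ex P (fun w => A (X i w) p q) = 0) -> mx_avoids F ->
  Ex P (fun w => \tr (A (X i w) *m F w)) = 0.
Proof.
move=> bA A0 aF.
have bAF p q : bmeas (fun w => A (X i w) p q * F w q p).
  by apply: bmeasM; [exact: (bmeasX i (bA p q))|exact: bmeas_avoids].
have -> : (fun w => \tr (A (X i w) *m F w)) =
    fun w => \sum_p \sum_q A (X i w) p q * F w q p.
  by apply/funext => w; apply: eq_bigr => p _; rewrite mxE.
rewrite Ex_sum => [|p _]; last by apply: bmeas_sum.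
rewrite big1 // => p _; rewrite Ex_sum // big1 // => q _.
by rewrite (Ex_avoids (bA p q) (aF q p)) A0 mul0r.
Qed.

End Independence.

(** * Trace moments of the deviation matrix *)

Section MatrixMeasurable.
Context {dT : measure_display} {T : measurableType dT} {R : realType}.
Variable k : nat.
Implicit Types F G : T -> 'M[R]_k.

Definition mx_bmeas F := forall p q, bmeas (fun x => F x p q).

Lemma mx_bmeas_cst (A : 'M[R]_k) : mx_bmeas (fun=> A).
Proof. by move=> p q; exact: bmeas_cst. Qed.

Lemma mx_bmeasB F G : mx_bmeas F -> mx_bmeas G -> mx_bmeas (fun x => F x - G x).
Proof.
move=> bF bG p q; have := bmeasB (bF p q) (bG p q); congr bmeas.
by apply/funext => x; rewrite !mxE.
Qed.

Lemma mx_bmeas_sum (I : Type) (r : seq I) (Q : pred I) (F : I -> T -> 'M[R]_k) :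
  (forall i, Q i -> mx_bmeas (F i)) ->
  mx_bmeas (fun x => \sum_(i <- r | Q i) F i x).
Proof.
move=> bF p q; have : bmeas (fun x => \sum_(i <- r | Q i) F i x p q).
  by apply: bmeas_sum => i Qi; exact: bF.
by congr bmeas; apply/funext => x; rewrite summxE.
Qed.

Lemma mx_bmeasM F G : mx_bmeas F -> mx_bmeas G -> mx_bmeas (fun x => F x *m G x).
Proof.
move=> bF bG p q; have : bmeas (fun x => \sum_l F x p l * G x l q).
  by apply: bmeas_sum => l _; exact: bmeasM.
by congr bmeas; apply/funext => x; rewrite mxE.
Qed.

Lemma mx_bmeasX F n : mx_bmeas F -> mx_bmeas (fun x => F x ^+ n).
Proof.
move=> bF; elim: n => [|n IH]; first exact: mx_bmeas_cst.
by move=> p q; have := mx_bmeasM bF IH p q; congr bmeas; apply/funext => x;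
  rewrite exprS.
Qed.

Lemma bmeas_trace F : mx_bmeas F -> bmeas (fun x => \tr (F x)).
Proof. by move=> bF; apply: bmeas_sum => i _; exact: bF. Qed.

End MatrixMeasurable.

Section Moments.
Context {dS dT : measure_display} {S : measurableType dS}
  {T : measurableType dT} {R : realType}.
Variables (P : probability S R) (N : nat) (X : 'I_N -> S -> T).
Hypothesis mX : forall i, measurable_fun setT (X i).
Hypothesis indep : forall A : 'I_N -> set T, (forall i, measurable (A i)) ->
  Ex P (fun w => \prod_i \1_(A i) (X i w)) =
  \prod_i Ex P (fun w => \1_(A i) (X i w)).
Variables (k : nat) (y : T -> 'cV[R]_k) (d : 'rV[R]_k) (L : R).
Hypothesis b_y : forall p, bmeas (fun x => y x p 0).
Hypothesis second_moment : forall i p q,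
  Ex P (fun w => y (X i w) p 0 * y (X i w) q 0) = diag_mx d p q.
Hypothesis y_le : forall i,
  {ae P, forall w, frob (y (X i w)) (y (X i w)) <= L}.
Hypothesis d_ge0 : forall j, 0 <= d 0 j.
Hypothesis d_le1 : forall j, d 0 j <= 1.
Hypothesis N_gt0 : (0 < N)%N.

Let D := diag_mx d.
Definition centered x : 'M[R]_k := y x *m (y x)^T - diag_mx d.
Let A i w := centered (X i w).
Definition deviation w := \sum_i A i w.
Let W := deviation.
Let Y i w := W w - A i w.

Let bA i : mx_bmeas (A i).
Proof.
move=> p q.
have : bmeas (fun w => y (X i w) p 0 * y (X i w) q 0 - diag_mx d p q).
  apply: bmeasB (bmeas_cst _).
  by apply: bmeasM; [exact: (bmeasX mX i (b_y p))|exact: (bmeasX mX i (b_y q))].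
by congr bmeas; apply/funext => w; rewrite !mxE big_ord1 !mxE.
Qed.

Let bW : mx_bmeas W.
Proof. by apply: mx_bmeas_sum => i _; exact: bA. Qed.

Let bY i : mx_bmeas (Y i).
Proof. exact: mx_bmeasB bW (bA i). Qed.

Let sA i w : symmx (A i w).
Proof. exact: symmx_centered. Qed.

Lemma symmx_deviation w : symmx (deviation w).
Proof.
rewrite /symmx /deviation raddf_sum /=; apply: eq_bigr => i _; exact: sA.
Qed.

Let sW w : symmx (W w) := symmx_deviation w.

Let sY i w : symmx (Y i w).
Proof. by rewrite /symmx linearB /= sW sA. Qed.

Let WYA i w : W w - Y i w = A i w.
Proof. by rewrite /Y opprB addrC subrK. Qed.

Let Ex_AY i m : Ex P (fun w => \tr (A i w * Y i w ^+ m)) = 0.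
Proof.
apply: (Ex_trace_avoids mX indep (A := centered)).
- move=> p q.
  have : bmeas (fun x => y x p 0 * y x q 0 - diag_mx d p q).
    by apply: bmeasB (bmeas_cst _); exact: bmeasM.
  by congr bmeas; apply/funext => x; rewrite !mxE big_ord1 !mxE.
- move=> p q; transitivity
    (Ex P (fun w => y (X i w) p 0 * y (X i w) q 0 - diag_mx d p q)).
    by congr Ex; apply/funext => w; rewrite !mxE big_ord1 !mxE.
  rewrite ExB; [|apply: bmeasM|exact: bmeas_cst]; last 2 first.
  + exact: (bmeasX mX i (b_y p)).
  + exact: (bmeasX mX i (b_y q)).
  by rewrite second_moment Ex_cst subrr.
- apply: mx_avoidsX => p q.
  have : avoids X i (fun w => \sum_(j | j != i) A j w p q).
    apply: avoids_sum => j ji.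
    apply: (avoids_coord (g := fun x => centered x p q) _ ji).
    have : bmeas (fun x => y x p 0 * y x q 0 - diag_mx d p q).
      by apply: bmeasB (bmeas_cst _); exact: bmeasM.
    by congr bmeas; apply/funext => x; rewrite !mxE big_ord1 !mxE.
  congr avoids; apply/funext => w.
  have -> : Y i w = \sum_(j | j != i) A j w.
    rewrite /Y /W /deviation (bigD1 i) //=.
    by rewrite [LHS]addrC addKr.
  by rewrite summxE.
Qed.

Let trD := \tr D.

Let trA x : \tr (centered x) = frob (y x) (y x) - trD.
Proof. by rewrite linearB /= mxtrace_mulC. Qed.

Let bsq i : bmeas (fun w => frob (y (X i w)) (y (X i w))).
Proof.
have := bmeasD (bmeas_trace (bA i)) (bmeas_cst trD).
by congr bmeas; apply/funext => w; rewrite trA subrK.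
Qed.

Lemma trace_diag_le : trD <= L.
Proof.
pose i := Ordinal N_gt0.
have E : Ex P (fun w => frob (y (X i w)) (y (X i w)) - trD) = 0.
  rewrite -(Ex_AY i 0); congr Ex; apply/funext => w.
  by rewrite expr0 mulr1 trA.
rewrite -subr_ge0 -(Ex_cst P (L - trD)) -E; apply: le_Ex_ae.
- exact: bmeasB (bsq i) (bmeas_cst _).
- exact: bmeas_cst.
- by apply: filterS (y_le i) => w; rewrite lerD2r.
Qed.

Let d_leL j : d 0 j <= L.
Proof.
apply: le_trans trace_diag_le; rewrite /trD mxtrace_diag (bigD1 j) //=.
by rewrite lerDl sumr_ge0.
Qed.

Let L_ge0 : 0 <= L.
Proof.
by apply: le_trans trace_diag_le; rewrite /trD mxtrace_diag sumr_ge0.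
Qed.

Let m n := Ex P (fun w => \tr (W w ^+ n)).

Let b_trWn n : bmeas (fun w => \tr (W w ^+ n)).
Proof. exact/bmeas_trace/mx_bmeasX. Qed.

Let b_trYn i n : bmeas (fun w => \tr (Y i w ^+ n)).
Proof. exact/bmeas_trace/mx_bmeasX. Qed.

Let b_trAW i n : bmeas (fun w => \tr (A i w * W w ^+ n)).
Proof. by apply: bmeas_trace; apply: mx_bmeasM => //; exact: mx_bmeasX. Qed.

Let b_trAY i n : bmeas (fun w => \tr (A i w * Y i w ^+ n)).
Proof. by apply: bmeas_trace; apply: mx_bmeasM => //; exact: mx_bmeasX. Qed.

Let b_trAAW i n : bmeas (fun w => \tr (A i w * A i w * W w ^+ n)).
Proof.
apply: bmeas_trace; apply: mx_bmeasM; first exact: mx_bmeasM.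
exact: mx_bmeasX.
Qed.

Let b_trAAY i n : bmeas (fun w => \tr (A i w * A i w * Y i w ^+ n)).
Proof.
apply: bmeas_trace; apply: mx_bmeasM; first exact: mx_bmeasM.
exact: mx_bmeasX.
Qed.

(** trace_centered_sqr_le with D <= I; the powers of an even exponent have the
    form Z Z^T which that lemma expects. *)
Let sqr_le i n (Z : S -> 'M[R]_k) : (forall w, symmx (Z w)) ->
  {ae P, forall w, \tr (A i w * A i w * Z w ^+ n.*2) <=
    2 * L * \tr (A i w * Z w ^+ n.*2) + 4 * L * \tr (Z w ^+ n.*2)}.
Proof.
move=> sZ; apply: filterS (y_le i) => w yL.
have ZE : Z w ^+ n.*2 = Z w ^+ n *m (Z w ^+ n)^T.
  by rewrite symmxX // mulmxE -exprD addnn.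
rewrite ZE; apply: le_trans (trace_centered_sqr_le d_ge0 _ yL d_leL) _.
have := ler_wpM2l L_ge0 (trace_diag_gram_le (Z w ^+ n) d_le1).
rewrite -/(centered (X i w)) -/(A i w) mulmxE -!mulmxE.
set ZZ := _ *m (_ ^+ n)^T.
set t1 := \tr (A i w *m ZZ); set t2 := \tr (diag_mx d *m ZZ).
lra.
Qed.

(** W is Y_i plus an independent centred matrix, so the linear term of the
    tangent inequality has mean zero. *)
Let jensen i n : Ex P (fun w => \tr (Y i w ^+ n.+1.*2)) <= m n.+1.*2.
Proof.
have E : Ex P (fun w => \tr (Y i w ^+ n.+1.*2) +
    n.+1.*2%:R * \tr (A i w * Y i w ^+ n.*2.+1)) =
    Ex P (fun w => \tr (Y i w ^+ n.+1.*2)).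
  rewrite ExD // ?ExZ // ?Ex_AY ?mulr0 ?addr0 //; exact: bmeasZ.
rewrite -E; apply: le_Ex => //; first by apply: bmeasD => //; exact: bmeasZ.
by move=> w; rewrite -(WYA i); exact: trace_even_power_tangent.
Qed.

Let m_ge0 n : 0 <= m n.*2.
Proof. by apply: Rintegral_ge0 => w _; exact: trace_even_power_ge0. Qed.

Let m_sum n : m n.+1 = \sum_i Ex P (fun w => \tr (A i w * W w ^+ n)).
Proof.
rewrite -Ex_sum //; congr Ex; apply/funext => w.
by rewrite exprS {1}/W /deviation mulr_suml raddf_sum.
Qed.

(** Here the trace of D, bounded by L, replaces the trace of the identity: the
    dimension k never enters. *)
Let moment_base : m 2 <= 4 * N%:R * L ^+ 2.
Proof.
rewrite m_sum; apply: (@le_trans _ _ (\sum_(i < N) 4 * L ^+ 2)); last first.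
  by rewrite sumr_const card_ord -mulr_natl; lra.
apply: ler_sum => i _.
have -> : Ex P (fun w => \tr (A i w * W w ^+ 1)) =
    Ex P (fun w => \tr (A i w * A i w * W w ^+ 0)).
  rewrite -[RHS]addr0 -(Ex_AY i 1) -ExD //; congr Ex; apply/funext => w.
  by rewrite !expr1 expr0 mulr1 -mxtraceD -mulrDr /Y addrC subrK.
apply: (@le_trans _ _ (Ex P (fun w => 2 * L * \tr (A i w * Y i w ^+ 0) + 4 * L ^+ 2))).
  apply: le_Ex_ae => //.
    by apply: bmeasD; [exact: bmeasZ|exact: bmeas_cst].
  apply: filterS (y_le i) => w yL.
  have := trace_centered_sqr_le d_ge0 (1%:M : 'M[R]_k) yL d_leL.
  rewrite trmx1 !mulmx1 -/(centered (X i w)) -/(A i w) !expr0 !mulr1 => le1.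
  apply: le_trans le1 _; have := trace_diag_le; rewrite /trD /D.
  by have := L_ge0; nra.
rewrite (ExD _ (bmeasZ _ (b_trAY i 0)) (bmeas_cst _)) (ExZ _ _ (b_trAY i 0)).
by rewrite Ex_AY Ex_cst mulr0 add0r.
Qed.

(** The leave-one-out expansion of E[tr W^(2p+2)]. Its odd moment
    E[tr W^(2p+1)] is split by trace_odd_power_le so that half of the left-hand
    side is absorbed. *)
Let moment_step n : let c := n.+1.*2.+1%:R in L * c <= N%:R ->
  m n.+2.*2 <= 20 * L * N%:R * c * m n.+1.*2.
Proof.
move=> c Lc.
have c_ge0 : 0 <= c by rewrite /c ler0n.
set p := n.+1.
have termwise i : Ex P (fun w => \tr (A i w * W w ^+ p.*2.+1)) <=
    c * (2 * L * Ex P (fun w => \tr (A i w * W w ^+ p.*2)) + 8 * L * m p.*2).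
  have -> : Ex P (fun w => \tr (A i w * W w ^+ p.*2.+1)) =
      Ex P (fun w => \tr (A i w * W w ^+ p.*2.+1) - \tr (A i w * Y i w ^+ p.*2.+1)).
    by rewrite ExB // Ex_AY subr0.
  apply: (@le_trans _ _ (Ex P (fun w =>
    c * (\tr (A i w * A i w * W w ^+ p.*2) + \tr (A i w * A i w * Y i w ^+ p.*2))))).
    apply: le_Ex; [exact: bmeasB|by apply: bmeasZ; exact: bmeasD|].
    by move=> w; rewrite -(WYA i); exact: trace_odd_power_diff.
  rewrite ExZ ?ExD //; last exact: bmeasD.
  rewrite ler_wpM2l //.
  have L4 : 0 <= 4 * L by exact: mulr_ge0.
  have leW : Ex P (fun w => \tr (A i w * A i w * W w ^+ p.*2)) <=
      2 * L * Ex P (fun w => \tr (A i w * W w ^+ p.*2)) + 4 * L * m p.*2.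
    rewrite -!ExZ // -ExD //; try exact: bmeasZ.
    apply: le_Ex_ae => //; first by apply: bmeasD; exact: bmeasZ.
    exact: sqr_le.
  have leY : Ex P (fun w => \tr (A i w * A i w * Y i w ^+ p.*2)) <=
      4 * L * m p.*2.
    apply: (@le_trans _ _ (4 * L * Ex P (fun w => \tr (Y i w ^+ p.*2)))); last first.
      by apply: (ler_wpM2l L4); exact: jensen.
    rewrite -[leRHS]add0r -(mulr0 (2 * L)) -(Ex_AY i p.*2) -!ExZ // -ExD //;
      try exact: bmeasZ.
    apply: le_Ex_ae => //; first by apply: bmeasD; exact: bmeasZ.
    exact: sqr_le.
  apply: le_trans (lerD leW leY) _; rewrite -addrA lerD2l.
  by rewrite -!mulrDl -natrD.
have m_le : m p.*2.+2 <= c * (2 * L * m p.*2.+1 + 8 * L * N%:R * m p.*2).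
  rewrite m_sum; apply: le_trans (ler_sum _ (fun i _ => termwise i)) _.
  rewrite -mulr_sumr big_split /= -mulr_sumr -m_sum sumr_const card_ord.
  rewrite ler_wpM2l // lerD2l -[_ *+ N]mulr_natl.
  by rewrite mulrA [N%:R * _]mulrC.
pose a := 2 * c * L.
have odd_le : 2 * a * m p.*2.+1 <= m p.*2.+2 + a ^+ 2 * m p.*2.
  rewrite -!ExZ // -ExD //; last exact: bmeasZ.
  apply: le_Ex; [exact: bmeasZ|by apply: bmeasD => //; exact: bmeasZ|].
  by move=> w; exact: trace_odd_power_le.
have mp := m_ge0 p.
have cL : c * L * m p.*2 * (c * L) <= c * L * m p.*2 * N%:R.
  by rewrite ler_wpM2l ?(mulrC c) // !mulr_ge0.
rewrite doubleS; move: odd_le m_le cL mp; rewrite /a {termwise}.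
move: (m p.*2.+2) (m p.*2.+1) (m p.*2) => m2 m1 m0; lra.
Qed.

Lemma trace_moment_le n : let c := n.*2.+1%:R in L * c <= N%:R ->
  m n.+1.*2 <= (20 * L * N%:R * c) ^+ n * (4 * N%:R * L ^+ 2).
Proof.
move=> c Lc.
have c_ge0 : 0 <= c by rewrite /c ler0n.
suff le_m j : (j <= n)%N ->
    m j.+1.*2 <= (20 * L * N%:R * c) ^+ j * (4 * N%:R * L ^+ 2) by exact: le_m.
elim: j => [|j IH] lt_jn; first by rewrite mul1r; exact: moment_base.
have cj : j.+1.*2.+1%:R <= c by rewrite ler_nat ltnS leq_double.
have Lcj : L * j.+1.*2.+1%:R <= N%:R by apply: le_trans Lc; rewrite ler_wpM2l.
apply: le_trans (moment_step Lcj) _.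
rewrite exprS -[leRHS]mulrA; apply: ler_pM => //; last exact: IH (ltnW lt_jn).
  by rewrite !mulr_ge0.
by rewrite ler_wpM2l // !mulr_ge0.
Qed.

(** Markov's inequality for tr W^(2n+2) at the level (N/4)^(2n+2). Each factor
    20 L N (2n+1) of the moment bound is at most half of (N/4)^2, and the n
    halvings compensate the factor N of the first moment. *)
Lemma deviation_concentration (delta : R) n : (N <= 2 ^ n)%N -> 0 <= delta ->
  640 * L * n.*2.+1%:R <= N%:R -> 64 * L <= delta * N%:R ->
  exists E : set S, [/\ measurable E, ((1 - delta)%:E <= P E)%E &
    forall w (h : 'cV[R]_k), E w ->
      `|frob h (deviation w *m h)| <= N%:R / 4 * frob h h].
Proof.
move=> le_N2n delta_ge0 Lc Ld; set c : R := n.*2.+1%:R in Lc.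
have N0 : 0 < N%:R :> R by rewrite ltr0n.
have c_ge1 : 1 <= c by rewrite /c ler1n.
have LcN : L * c <= N%:R.
  have := mulr_ge0 L_ge0 (le_trans ler01 c_ge1); lra.
have LN : L <= N%:R.
  by apply: le_trans LcN; rewrite ler_peMr.
pose t : R := N%:R / 4.
have t_gt0 : 0 < t by rewrite /t divr_gt0.
pose a := t ^+ n.+1.*2.
have a_gt0 : 0 < a by rewrite exprn_gt0.
exists [set w | \tr (W w ^+ n.+1.*2) <= a]; split.
- exact: measurable_sublevel.
- apply: le_trans (Ex_markov P (b_trWn n.+1.*2) _ a_gt0); last first.
    by move=> w; exact: trace_even_power_ge0.
  rewrite lee_fin lerD2l lerN2 ler_pdivrMr //.
  apply: le_trans (trace_moment_le LcN) _.
  pose b : R := N%:R ^+ 2 / 16.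
  have b_ge0 : 0 <= b by rewrite /b divr_ge0 ?sqr_ge0.
  have aE : a = b ^+ n * b.
    rewrite -exprSr /a -mul2n exprM; congr (_ ^+ _).
    by rewrite /t /b; field.
  have pow_le : N%:R * (20 * L * N%:R * c) ^+ n <= b ^+ n.
    apply: (@le_trans _ _ (2 ^+ n * (b / 2) ^+ n)).
      apply: ler_pM => //; [|by rewrite -natrX ler_nat|].
        by rewrite exprn_ge0 // !mulr_ge0 // (le_trans ler01).
      apply: lerXn2r; rewrite ?nnegrE; [|by rewrite divr_ge0|].
        by rewrite !mulr_ge0 // (le_trans ler01).
      have := ler_wpM2r (ltW N0) Lc; rewrite /b; lra.
    by rewrite -exprMn mulrC divfK.
  have -> : (20 * L * N%:R * c) ^+ n * (4 * N%:R * L ^+ 2) =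
      (N%:R * (20 * L * N%:R * c) ^+ n) * (4 * L ^+ 2) by ring.
  apply: le_trans (ler_wpM2r _ pow_le) _; first by rewrite mulr_ge0 ?sqr_ge0.
  rewrite aE [leRHS]mulrCA ler_wpM2l ?exprn_ge0 //.
  have := ler_pM (mulr_ge0 (ler0n _ 64) L_ge0) L_ge0 Ld LN.
  by rewrite /b; lra.
- move=> w h /= trW; exact: (quad_form_le h (sW w) t_gt0 (ltn0Sn n) trW).
Qed.

End Moments.

(** * Evaluation in the reproducing kernel Hilbert space *)

Section InnerProduct.
Context {R : realType} {H : completeNormedModType R}.
Variable ip : H -> H -> R.
Hypothesis ipC : forall f g, ip f g = ip g f.
Hypothesis ip_linear : forall (a : R) f g h,
  ip (a *: f + g) h = a * ip f h + ip g h.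

Lemma ipDl f g h : ip (f + g) h = ip f h + ip g h.
Proof. by have := ip_linear 1 f g h; rewrite scale1r mul1r. Qed.

Lemma ip0l h : ip 0 h = 0.
Proof. by have := ipDl 0 0 h; rewrite addr0 => /eqP; rewrite -subr_eq0 opprD addNKr oppr_eq0 => /eqP. Qed.

Lemma ipZl a f h : ip (a *: f) h = a * ip f h.
Proof. by have := ip_linear a f 0 h; rewrite addr0 ip0l addr0. Qed.

Lemma ip_suml (I : Type) (r : seq I) (Q : pred I) (F : I -> H) h :
  ip (\sum_(i <- r | Q i) F i) h = \sum_(i <- r | Q i) ip (F i) h.
Proof.
elim: r => [|i r IH]; first by rewrite !big_nil ip0l.
by rewrite !big_cons; case: ifP => // _; rewrite ipDl IH.
Qed.

Lemma ip_quad s t f g :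
  ip (s *: f + t *: g) (s *: f + t *: g) =
  s ^+ 2 * ip f f + s * t * 2 * ip f g + t ^+ 2 * ip g g.
Proof.
rewrite ipDl !ipZl ![ip _ (_ + _)]ipC !ipDl !ipZl [ip g f]ipC.
ring.
Qed.

Lemma ip_cauchy_schwarz f g : (forall h, 0 <= ip h h) ->
  ip f g ^+ 2 <= ip f f * ip g g.
Proof. by move=> ge0; apply: discriminant_le => s t; rewrite -ip_quad. Qed.

Variables (sigma : nat -> R) (e : nat -> H) (k : nat).
Hypothesis ortho : forall i j : 'I_k, ip (e i) (e j) = (i == j)%:R.

Lemma ip_span_coord (a : 'I_k -> R) (i : 'I_k) :
  ip (e i) (\sum_j a j *: e j) = a i.
Proof.
rewrite ipC ip_suml (bigD1 i) //= ipZl ortho eqxx mulr1 big1 ?addr0 // => j ji.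
by rewrite ipZl ortho (negbTE ji) mulr0.
Qed.

Lemma ip_span (a : 'I_k -> R) h :
  ip (\sum_j a j *: e j) h = \sum_j a j * ip (e j) h.
Proof. by rewrite ip_suml; apply: eq_bigr => j _; rewrite ipZl. Qed.

Lemma ip_span_sqr (a : 'I_k -> R) :
  ip (\sum_j a j *: e j) (\sum_j a j *: e j) = \sum_j a j ^+ 2.
Proof.
by rewrite ip_span; apply: eq_bigr => j _; rewrite ip_span_coord expr2.
Qed.

Lemma ip_proj1k h (a : 'I_k -> R) :
  ip (proj1k ip e k h) (\sum_j a j *: e j) = ip h (\sum_j a j *: e j).
Proof.
rewrite /proj1k /diag_op ip_span; under eq_bigr do rewrite mul1r ip_span_coord.
rewrite [RHS]ipC ip_span; apply: eq_bigr => j _; exact: mulrC.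
Qed.

End InnerProduct.

(** The sigma-algebra generated by the open sets of T makes continuous functions
    measurable, T being an arbitrary topological space. *)
Lemma continuous_bmeas {R : realType} {T : ptopologicalType} (f : T -> R) B :
  continuous f -> (forall x, `|f x| <= B) -> bmeas (f : borelType T -> R).
Proof.
move=> cf fB; split; last by exists B.
apply: (measurability _ (RGenOpens.measurableE R)) => _ [_ [a [b ->] <-]].
rewrite setTI; apply: sub_sigma_algebra.
by move/continuousP: cf; apply; exact: interval_open.
Qed.

Section Rkhs.
Context {R : realType} {T : ptopologicalType} {H : completeNormedModType R}.
Variables (K : T -> T -> R) (ip : H -> H -> R) (ev : H -> T -> R) (phi : T -> H).
Hypothesis cK : continuous (fun xy : T * T => K xy.1 xy.2).
Hypothesis K_le1 : forall x y, `|K x y| <= 1.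
Hypothesis rkhs : is_rkhs K ip ev phi.

Let ipC := rkhs_ipC rkhs.
Let ip_linear := rkhs_ip_linear rkhs.
Let ip_ge0 := rkhs_ip_ge0 rkhs.

Lemma ip_phi x y : ip (phi x) (phi y) = K x y.
Proof. by rewrite -(rkhs_reproducing rkhs) (rkhs_ev_phi rkhs). Qed.

Lemma rkhs_ev_le f x : `|ev f x| <= Num.sqrt (ip f f).
Proof.
rewrite -sqrtr_sqr ler_sqrt // (rkhs_reproducing rkhs).
apply: le_trans (ip_cauchy_schwarz ipC ip_linear _ _ ip_ge0) _.
rewrite ip_phi ler_piMr //; exact: le_trans (ler_norm _) (K_le1 x x).
Qed.

(** |f(x) - f(y)|^2 <= |f|^2 |phi(x) - phi(y)|^2, and the last factor is
    K(x,x) - 2 K(x,y) + K(y,y). *)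
Lemma rkhs_ev_continuous f : continuous (ev f).
Proof.
move=> x; apply/cvgrPdist_lt => eps eps_gt0.
pose g y := ip f f * (K x x - 2 * K x y + K y y).
have ev_le y : (ev f x - ev f y) ^+ 2 <= g y.
  have -> : ev f x - ev f y = ip f (1 *: phi x + (- 1) *: phi y).
    rewrite !(rkhs_reproducing rkhs) [RHS]ipC (ipDl ip_linear).
    by rewrite !(ipZl ip_linear) mul1r mulN1r ![ip f _]ipC.
  apply: le_trans (ip_cauchy_schwarz ipC ip_linear _ _ ip_ge0) _.
  by rewrite (ip_quad ipC ip_linear) !ip_phi /g ler_wpM2l //; lra.
have cg : g y @[y --> x] --> g x.
  have c1 : K x y @[y --> x] --> K x x.
    have cp : (x, y) @[y --> x] --> (x, x).
      by apply: cvg_pair; [exact: cvg_cst|exact: cvg_id].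
    exact: (cvg_comp _ _ cp (@cK (x, x))).
  have c2 : K y y @[y --> x] --> K x x.
    have cp : (y, y) @[y --> x] --> (x, x) by apply: cvg_pair; exact: cvg_id.
    exact: (cvg_comp _ _ cp (@cK (x, x))).
  apply: cvgMr; apply: cvgD => //; apply: cvgB; first exact: cvg_cst.
  exact: cvgMr.
have gx : g x = 0 by rewrite /g; ring.
have : \forall y \near x, g y < eps ^+ 2.
  by apply: (cvgr_lt (g x)) => //; rewrite gx exprn_gt0.
apply: filterS => y gy.
rewrite -(@ltr_pXn2r _ 2) ?nnegrE ?(ltW eps_gt0) // real_normK ?num_real //.
exact: le_lt_trans (ev_le y) gy.
Qed.

Lemma bmeas_ev f : bmeas (ev f : borelType T -> R).
Proof. exact: continuous_bmeas (rkhs_ev_continuous (f := f)) (rkhs_ev_le f). Qed.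

End Rkhs.

(** * Samples of a common law *)

Section Transfer.
Context {R : realType} {dS : measure_display} {S : measurableType dS}.
Variable P : probability S R.
Context {T : ptopologicalType} {N : nat}.
Variables (X : 'I_N -> {RV P >-> borelType T}) (mu : probability (borelType T) R).
Hypothesis iid : iid_with_law X mu.

Lemma Ex_law i (g : borelType T -> R) : bmeas g ->
  Ex P (fun w => g (X i w)) = Ex mu g.
Proof.
move=> bg; rewrite /Ex /Rintegral; congr fine.
have -> : (\int[mu]_x (g x)%:E = \int[distribution P (X i)]_x (g x)%:E)%E.
  by apply: eq_measure_integral => A mA _; symmetry; exact: (iid.2 i A mA).
rewrite integral_distribution //; first by apply/measurable_EFinP; exact: bg.1.
exact: (bmeas_integrable P (bmeas_comp bg (measurable_funPT (X i)))).
Qed.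

Lemma Ex_prod_indic (A : 'I_N -> set (borelType T)) :
  (forall i, measurable (A i)) ->
  Ex P (fun w => \prod_i \1_(A i) (X i w)) =
  \prod_i Ex P (fun w => \1_(A i) (X i w)).
Proof.
move=> mA.
have mXA i : measurable (X i @^-1` A i).
  by rewrite -[X in measurable X]setTI; exact: measurable_funPT.
have -> : (fun w => \prod_i \1_(A i) (X i w)) =
    \1_(\bigcap_(i in [set` [set: 'I_N]%SET]) X i @^-1` A i) :> (S -> R).
  apply/funext => w; rewrite indicE; case: (boolP (w \in _)) => [|nw].
    by rewrite inE => Aw; rewrite big1 // => i _; rewrite indicE mem_set //;
      apply: Aw; rewrite /= inE.
  have [i nAi] : exists i, ~ A i (X i w).
    apply/existsNP => Aw; move/negP: nw; apply; rewrite inE => i _.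
    exact: Aw.
  by rewrite (bigD1 i) //= indicE memNset // mul0r.
rewrite Ex_indic; last by apply: fin_bigcap_measurable => // i _; exact: mXA.
rewrite (iid.1 finset.setT A mA).
rewrite (eq_bigr (fun i => (fine (P (X i @^-1` A i)))%:E)); last first.
  by move=> i _; rewrite fineK // fin_num_measure.
rewrite prodEFin /=; apply: eq_big => [i|i _]; first by rewrite inE.
by rewrite -Ex_indic.
Qed.

End Transfer.

(** * Second moments and the cone *)

Section Spectral.
Context {R : realType} {T : ptopologicalType} {H : completeNormedModType R}.
Variables (K : T -> T -> R) (ip : H -> H -> R) (ev : H -> T -> R) (phi : T -> H).
Hypothesis cK : continuous (fun xy : T * T => K xy.1 xy.2).
Hypothesis K_le1 : forall x y, `|K x y| <= 1.
Hypothesis rkhs : is_rkhs K ip ev phi.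
Variables (mu : probability (borelType T) R) (Gamma : H -> H).
Hypothesis GammaE : is_second_moment ip mu phi Gamma.
Variables (sigma : nat -> R) (e : nat -> H) (k : nat).
Hypothesis spectral : is_spectral_decomposition ip Gamma sigma e.
Hypothesis sigma_gt0 : forall j, (j < k)%N -> 0 < sigma j.

Let ipC := rkhs_ipC rkhs.
Let ip_linear := rkhs_ip_linear rkhs.
Let sg (j : 'I_k) : 0 < sigma j := sigma_gt0 (ltn_ord j).

Lemma eigen_ortho (i j : 'I_k) : ip (e i) (e j) = (i == j)%:R.
Proof. by rewrite (spectral_orthonormal spectral). Qed.

Lemma Ex_ev_mul f g :
  Ex mu (fun x => ev f x * ev g x) = ip (Gamma f) g.
Proof.
rewrite GammaE; congr Ex; apply/funext => x.
by rewrite !(rkhs_reproducing rkhs) ![ip (phi x) _]ipC.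
Qed.

Lemma Ex_ev_eigen (i j : 'I_k) :
  Ex mu (fun x => ev (e i) x * ev (e j) x) = sigma i * (i == j)%:R.
Proof.
by rewrite Ex_ev_mul (spectral_eigen spectral) // (ipZl ip_linear) eigen_ortho.
Qed.

(** The symmetry of the second moment moves Gamma from f onto the eigenvectors,
    where its values are known. *)
Lemma Ex_ev_sqr (a : 'I_k -> R) :
  Ex mu (fun x => ev (\sum_(j < k) a j *: e j) x ^+ 2) = \sum_(j < k) sigma j * a j ^+ 2.
Proof.
set f := \sum_(j < k) a j *: e j.
transitivity (ip (Gamma f) f).
  by rewrite -Ex_ev_mul; congr Ex; apply/funext => x; rewrite expr2.
rewrite {2}/f ipC (ip_span ip_linear); apply: eq_bigr => j _.
have -> : ip (e j) (Gamma f) = ip (Gamma (e j)) f.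
  rewrite ipC -!Ex_ev_mul; congr Ex; apply/funext => x; exact: mulrC.
rewrite (spectral_eigen spectral) // (ipZl ip_linear).
by rewrite (ip_span_coord ipC ip_linear eigen_ortho); ring.
Qed.

Lemma norm_span (a : 'I_k -> R) :
  `|\sum_(j < k) a j *: e j| = Num.sqrt (\sum_j a j ^+ 2).
Proof.
by rewrite (rkhs_norm rkhs) (ip_span_sqr ipC ip_linear eigen_ortho).
Qed.

Lemma diag_op_span w (a : 'I_k -> R) :
  diag_op ip e k w (\sum_(j < k) a j *: e j) = \sum_(j < k) (w j * a j) *: e j.
Proof.
by apply: eq_bigr => j _; rewrite (ip_span_coord ipC ip_linear eigen_ortho).
Qed.

Lemma norm_Gamma1k_half (a : 'I_k -> R) :
  `|Gamma1k_half ip sigma e k (\sum_(j < k) a j *: e j)| =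
  Num.sqrt (\sum_(j < k) sigma j * a j ^+ 2).
Proof.
rewrite /Gamma1k_half diag_op_span norm_span; congr Num.sqrt.
by apply: eq_bigr => j _; rewrite exprMn sqr_sqrtr // ltW.
Qed.

Lemma L2norm_span (a : 'I_k -> R) :
  ('N[mu]_2%:E[(fun x => (ev (\sum_(j < k) a j *: e j)%R x)%:E)] =
  (Num.sqrt (\sum_(j < k) sigma j * a j ^+ 2)%R)%:E)%E.
Proof.
set f := \sum_(j < k) a j *: e j.
have bf : bmeas (ev f : borelType T -> R) := bmeas_ev cK K_le1 rkhs f.
rewrite unlock /Lnorm -(Ex_ev_sqr a) -/f.
have -> : (\int[mu]_x (`|(ev f x)%:E| `^ 2))%E =
    (Ex mu (fun x => ev f x ^+ 2))%:E.
  rewrite /Ex /Rintegral fineK; last first.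
    by apply: integrable_fin_num => //; apply: bmeas_integrable; exact: bmeasM.
  apply: eq_integral => x _ /=.
  by rewrite powR_mulrn // real_normK // num_real.
rewrite poweR_EFin powR12_sqrt //.
by apply: Rintegral_ge0 => x _; exact: sqr_ge0.
Qed.

Lemma coneC1k_spanP r (a : 'I_k -> R) :
  coneC1k mu ev e k r (\sum_(j < k) a j *: e j) <->
  r * Num.sqrt (\sum_j a j ^+ 2) <= Num.sqrt (\sum_(j < k) sigma j * a j ^+ 2).
Proof.
rewrite /coneC1k /= L2norm_span norm_span lee_fin; split=> [[]//|le_r].
by split=> //; exists a.
Qed.

(** A multiple of an element of C(r) has |f|_(L_2) as its factor: the elements
    of Gamma_(1:k)^(-1/2) S have unit norm in L_2, and those of r^-1 B satisfy
    r |f|_H <= 1. Positivity of sigma_1, ..., sigma_k is what makes a nonzero f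
    have a nonzero factor. *)
Lemma cone_setC1k r : 0 < r ->
  cone (setC1k ip sigma e k r) = coneC1k mu ev e k r.
Proof.
move=> r_gt0; apply/seteqP; split=> f.
- case=> [->|].
    have <- : \sum_(j < k) (0 : R) *: e j = 0.
      by rewrite big1 // => j _; rewrite scale0r.
    apply/coneC1k_spanP.
    by rewrite big1 ?sqrtr0 ?mulr0 // => j _; rewrite expr0n.
  case=> t [g [t_gt0 [[h [_ h_le1] gh] [b [[beta bE] b1] gb]] ->]].
  pose s (j : 'I_k) := Num.sqrt (sigma j).
  have s_gt0 j : 0 < s j by rewrite sqrtr_gt0.
  have gE : g = \sum_(j < k) ((s j)^-1 * beta j) *: e j.
    by rewrite -gb bE /Gamma1k_mhalf diag_op_span.
  have tgE : t *: g = \sum_(j < k) (t * ((s j)^-1 * beta j)) *: e j.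
    by rewrite gE scaler_sumr; apply: eq_bigr => j _; rewrite scalerA.
  have beta1 : \sum_j beta j ^+ 2 = 1.
    rewrite -[LHS]sqr_sqrtr ?sumr_ge0 // => [|j _]; last exact: sqr_ge0.
    by rewrite -norm_span -bE b1 expr1n.
  rewrite tgE; apply/coneC1k_spanP; rewrite -norm_span -tgE.
  have -> : \sum_(j < k) sigma j * (t * ((s j)^-1 * beta j)) ^+ 2 = t ^+ 2.
    rewrite -[RHS]mulr1 -beta1 mulr_sumr; apply: eq_bigr => j _.
    rewrite !exprMn exprVn sqr_sqrtr ?(ltW (sg j)) //.
    by field; rewrite gt_eqF.
  rewrite sqrtr_sqr gtr0_norm // -gh scalerA normrZ.
  rewrite gtr0_norm ?divr_gt0 // mulrA mulrCA mulrA mulfK ?gt_eqF //.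
  by rewrite ler_piMr // ltW.
- case=> [[a ->]] le_f; have /coneC1k_spanP : coneC1k mu ev e k r (\sum_(j < k) a j *: e j).
    by split=> //; exists a.
  set t := Num.sqrt (\sum_(j < k) sigma j * _); set f' := \sum_(j < k) a j *: e j => le_t.
  have S_ge0 : 0 <= \sum_(j < k) sigma j * a j ^+ 2.
    by apply: sumr_ge0 => j _; rewrite mulr_ge0 ?sqr_ge0 // ltW.
  have [t0|t_neq0] := eqVneq t 0.
    left; rewrite /= /f' big1 // => j _.
    have /eqP : \sum_(j < k) sigma j * a j ^+ 2 = 0.
      by rewrite -[LHS]sqr_sqrtr // -/t t0 expr0n.
    rewrite psumr_eq0 => [/allP/(_ j (mem_index_enum j))|i _]; last first.
      by rewrite mulr_ge0 ?sqr_ge0 // ltW.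
    by rewrite /= mulf_eq0 gt_eqF //= expf_eq0 /= => /eqP ->; rewrite scale0r.
  have t_gt0 : 0 < t by rewrite lt_neqAle eq_sym t_neq0 sqrtr_ge0.
  right; exists t, (t^-1 *: f'); split=> //; last by rewrite scalerA divff // scale1r.
  split.
    exists (r *: (t^-1 *: f')); last by rewrite scalerA mulVf ?scale1r ?gt_eqF.
    split.
      exists (fun j : 'I_k => r * (t^-1 * a j)); rewrite /f' !scaler_sumr.
      by apply: eq_bigr => j _; rewrite !scalerA !mulrA.
    rewrite /= !normrZ gtr0_norm // gtr0_norm ?invr_gt0 // mulrCA mulrC.
    by rewrite ler_pdivrMr // mul1r /f' norm_span.
  exists (\sum_(j < k) (Num.sqrt (sigma j) * (t^-1 * a j)) *: e j).
    split; first by exists (fun j : 'I_k => Num.sqrt (sigma j) * (t^-1 * a j)).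
    rewrite /= norm_span -[RHS]sqrtr1; congr Num.sqrt.
    transitivity (t^-1 ^+ 2 * \sum_(j < k) sigma j * a j ^+ 2); last first.
      by rewrite -[\sum_(j < k) _ * _]sqr_sqrtr // -/t -exprMn mulVf // expr1n.
    rewrite mulr_sumr; apply: eq_bigr => j _.
    by rewrite !exprMn sqr_sqrtr ?(ltW (sg j)) //; ring.
  rewrite /Gamma1k_mhalf diag_op_span /f' scaler_sumr; apply: eq_bigr => j _.
  by rewrite scalerA mulrA mulVf ?mul1r // gt_eqF // sqrtr_gt0.
Qed.

End Spectral.

(** * Truncated weights and the threshold *)

Section Weights.
Context {R : realType} {T : ptopologicalType} {H : completeNormedModType R}.
Variables (K : T -> T -> R) (ip : H -> H -> R) (ev : H -> T -> R) (phi : T -> H).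
Hypothesis K_le1 : forall x y, `|K x y| <= 1.
Hypothesis rkhs : is_rkhs K ip ev phi.
Variables (sigma : nat -> R) (e : nat -> H) (k : nat).
Hypothesis ortho : forall i j : 'I_k, ip (e i) (e j) = (i == j)%:R.
Hypothesis sigma_gt0 : forall j, (j < k)%N -> 0 < sigma j.

Let ipC := rkhs_ipC rkhs.
Let ip_linear := rkhs_ip_linear rkhs.
Let ip_ge0 := rkhs_ip_ge0 rkhs.

Definition weight (r : R) (j : nat) : R := Num.min r^-1 (Num.sqrt (sigma j))^-1.

Lemma weight_gt0 r (j : 'I_k) : 0 < r -> 0 < weight r j.
Proof. by move=> r0; rewrite lt_min !invr_gt0 r0 sqrtr_gt0 sigma_gt0. Qed.

Lemma weight_le r (j : nat) : weight r j <= r^-1.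
Proof. by rewrite ge_min lexx. Qed.

Lemma weight_sqr_sigma_le1 r (j : 'I_k) : 0 < r ->
  weight r j ^+ 2 * sigma j <= 1.
Proof.
move=> r0; have s0 := sigma_gt0 (ltn_ord j).
have w0 := weight_gt0 j r0.
have : weight r j <= (Num.sqrt (sigma j))^-1 by rewrite ge_min lexx orbT.
rewrite -(@ler_pXn2r _ 2) ?nnegrE ?invr_ge0 ?sqrtr_ge0 ?(ltW w0) //.
by rewrite exprVn sqr_sqrtr ?(ltW s0) // -[_^-1]div1r ler_pdivlMr.
Qed.

Lemma weight_inv_sqr_le r (j : 'I_k) : 0 < r ->
  (weight r j)^-1 ^+ 2 <= r ^+ 2 + sigma j.
Proof.
move=> r0; have s0 := sigma_gt0 (ltn_ord j).
rewrite /weight minEle; case: ifP => _.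
  by rewrite invrK lerDl ltW.
by rewrite invrK sqr_sqrtr ?(ltW s0) // lerDr sqr_ge0.
Qed.

(** The infimum defining R_N need not be attained, but some q < 2 r belongs to the
    set; passing from q to r costs a factor 2 only. *)
Lemma weight_half r q (j : nat) : 0 < q -> q <= 2 * r ->
  weight r j <= 2 * weight q j.
Proof.
move=> q0 q_le; have r0 : 0 < r by lra.
rewrite /weight minr_pMr //.
rewrite le_min !ge_min; apply/andP; split; apply/orP; [left|right].
  by rewrite -ler_pdivrMl // -invfM lef_pV2 ?posrE ?mulr_gt0 // mulrC.
have : 0 <= (Num.sqrt (sigma j))^-1 by rewrite invr_ge0 sqrtr_ge0.
lra.
Qed.

Lemma bar_norm_sqr r x :
  `|barGamma1k_mhalf ip sigma e k r (phi x)| ^+ 2 =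
  \sum_(j < k) (weight r j * ev (e j) x) ^+ 2.
Proof.
rewrite /barGamma1k_mhalf /diag_op (rkhs_norm rkhs) sqr_sqrtr //.
rewrite (ip_span_sqr ipC ip_linear ortho); apply: eq_bigr => j _.
by rewrite (rkhs_reproducing rkhs).
Qed.

Lemma bessel x : \sum_(j < k) ev (e j) x ^+ 2 <= 1.
Proof.
pose p := \sum_(j < k) ev (e j) x *: e j.
set s := \sum_(j < k) _.
have ppE : ip p p = s by rewrite (ip_span_sqr ipC ip_linear ortho).
have pxE : ip p (phi x) = s.
  rewrite (ip_span ip_linear); apply: eq_bigr => j _.
  by rewrite -(rkhs_reproducing rkhs) expr2.
have := ip_cauchy_schwarz ipC ip_linear p (phi x) ip_ge0.
rewrite pxE ppE (ip_phi rkhs).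
have s_ge0 : 0 <= s by rewrite -ppE.
have := le_trans (ler_norm _) (K_le1 x x).
rewrite expr2; have [-> _ _|s_neq0] := eqVneq s 0; first exact: ler01.
have s_gt0 : 0 < s by rewrite lt_neqAle eq_sym s_neq0.
by rewrite ler_pM2l // => K1 sK; exact: le_trans sK K1.
Qed.

(** Makes the set whose infimum is R_N nonempty: large radii satisfy any positive
    bound. *)
Lemma bar_norm_le r x : 0 < r ->
  `|barGamma1k_mhalf ip sigma e k r (phi x)| <= r^-1.
Proof.
move=> r0; have r1 : 0 <= r^-1 by rewrite invr_ge0 ltW.
rewrite -(@ler_pXn2r _ 2) ?nnegrE // bar_norm_sqr.
apply: (@le_trans _ _ (r^-1 ^+ 2 * \sum_(j < k) ev (e j) x ^+ 2)).
  rewrite mulr_sumr; apply: ler_sum => j _.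
  rewrite exprMn ler_wpM2r ?sqr_ge0 // lerXn2r ?nnegrE //.
    exact/ltW/weight_gt0.
  exact: weight_le.
by rewrite ler_piMr ?sqr_ge0 //; exact: bessel.
Qed.

Lemma bar_norm_half r q x : 0 < q -> q <= 2 * r ->
  `|barGamma1k_mhalf ip sigma e k r (phi x)| ^+ 2 <=
  4 * `|barGamma1k_mhalf ip sigma e k q (phi x)| ^+ 2.
Proof.
move=> q0 q_le; have r0 : 0 < r by lra.
rewrite !bar_norm_sqr mulr_sumr; apply: ler_sum => j _.
rewrite !exprMn [leRHS]mulrA ler_wpM2r ?sqr_ge0 //.
have -> : 4 * weight q j ^+ 2 = (2 * weight q j) ^+ 2 by ring.
rewrite lerXn2r ?nnegrE //; first exact/ltW/weight_gt0.
  by rewrite mulr_ge0 // ltW // weight_gt0.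
exact: weight_half.
Qed.

Section RN.
Context {dS : measure_display} {S : measurableType dS}.
Variables (P : probability S R) (N : nat) (X : 'I_N -> {RV P >-> borelType T}).

Lemma R_N_bound (c r : R) : (1 < N)%N -> 0 < c -> 0 < r ->
  R_N X ip phi sigma e k c <= r ->
  let B := c * (Num.sqrt N%:R / ln N%:R) in
  forall i, {ae P, forall w,
    `|barGamma1k_mhalf ip sigma e k r (phi (X i w))| ^+ 2 <= 4 * B ^+ 2}.
Proof.
move=> N_gt1 c0 r0 le_r B i.
have B_gt0 : 0 < B.
  rewrite mulr_gt0 // divr_gt0 ?sqrtr_gt0 ?ltr0n ?(ltnW N_gt1) //.
  by rewrite ln_gt0 // ltr1n.
have P_gt0 : (0 < P [set: S])%E by rewrite probability_setT.
move: le_r; rewrite /R_N; set Q := [set _ | _] => le_r.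
have infQ : has_inf Q.
  split; last by exists 0 => q [/ltW].
  exists B^-1; split; first by rewrite invr_gt0.
  rewrite unlock /Lnorm ifT; last exact: P_gt0.
  apply/ess_supP; apply: aeW => w /=; rewrite lee_fin.
  rewrite ger0_norm; last by apply: bigmax_ge_id.
  apply: bigmax_le => [|j _]; first exact: ltW.
  by rewrite -[leRHS]invrK bar_norm_le // invr_gt0.
have [q [q0 Nq] q_lt] := inf_adherent r0 infQ.
have q_le : q <= 2 * r by lra.
move: Nq; rewrite unlock /Lnorm ifT; last exact: P_gt0.
move=> /ess_supP.
apply: filterS => w /=; rewrite lee_fin => max_le.
apply: le_trans (bar_norm_half _ q0 q_le) _; rewrite ler_pM2l //.
rewrite lerXn2r ?nnegrE ?(ltW B_gt0) //.
apply: le_trans max_le; apply: le_trans (ler_norm _).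
exact: (le_bigmax _ (fun i => `|barGamma1k_mhalf ip sigma e k q (phi (X i w))|) i).
Qed.

End RN.

End Weights.

(** * Order of magnitude of the trace exponent *)

Lemma half_le_ln {R : realType} n : (1 < n)%N -> 2^-1 <= ln n%:R :> R.
Proof.
move=> n_gt1; have n0 : 0 < n%:R :> R by rewrite ltr0n ltnW.
rewrite -(expRK 2^-1) ler_ln ?posrE ?expR_gt0 //.
apply: (@le_trans _ _ 2); last by rewrite ler_nat.
rewrite -[expR _]invrK -expRN -[leRHS]invrK lef_pV2 ?posrE ?expR_gt0 //.
by apply: le_trans (expR_ge1Dx _); lra.
Qed.

(** The factor 2 stands for 1 / ln 2. *)
Lemma trunc_log_le_ln {R : realType} n : (1 < n)%N ->
  (trunc_log 2 n)%:R <= 2 * ln n%:R :> R.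
Proof.
move=> n_gt1; have n0 : 0 < n%:R :> R by rewrite ltr0n ltnW.
have pow_le : 2 ^+ trunc_log 2 n <= n%:R :> R.
  by rewrite -natrX ler_nat; exact: trunc_logP (ltnW n_gt1).
have : ln (2 ^+ trunc_log 2 n) <= ln n%:R :> R.
  by rewrite ler_ln ?posrE ?exprn_gt0.
rewrite lnXn // -[_ *+ trunc_log _ _]mulr_natr.
have := ler_wpM2r (ler0n R (trunc_log 2 n)) (@half_le_ln R 2 isT); lra.
Qed.

(** With L = 4 (c sqrt N / ln N)^2 and an exponent of order ln N, the ratio
    L (2n+1) / N is of order c^2 / ln N, and ln N >= 1/2. *)
Lemma sample_size_arith {R : realType} (delta c : R) N : 0 < delta < 1 ->
  0 < c < (100 * 10 ^+ 2 * delta^-1 ^+ 2)^-1 -> (1 < N)%N ->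
  let L := 4 * (c * (Num.sqrt N%:R / ln N%:R)) ^+ 2 in
  640 * L * (trunc_log 2 N).+1.*2.+1%:R <= N%:R /\ 64 * L <= delta * N%:R.
Proof.
move=> /andP[d0 d1] /andP[c0 cd] N_gt1 L.
have l_ge := @half_le_ln R N N_gt1.
have tl := @trunc_log_le_ln R N N_gt1.
set l := ln N%:R in l_ge tl L *.
have l0 : 0 < l by lra.
have N0 : 0 <= N%:R :> R by exact: ler0n.
have LE : L = 4 * c ^+ 2 * N%:R / l ^+ 2.
  by rewrite /L !exprMn sqr_sqrtr // exprVn; ring.
pose b := 100 * c.
have cE : c = b / 100 by rewrite /b; field.
have b0 : 0 < b by rewrite /b mulr_gt0.
have b_le : 100 * b <= delta ^+ 2.
  apply: ltW; have -> : 100 * b = 100 * 10 ^+ 2 * c by rewrite /b; ring.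
  rewrite mulrC -ltr_pdivlMr ?mulr_gt0 ?exprn_gt0 //.
  apply: lt_le_trans cd _; rewrite le_eqVlt; apply/orP; left; apply/eqP.
  by field; rewrite gt_eqF.
have bd : 100 * b <= delta.
  by apply: le_trans b_le _; rewrite expr2 ler_piMl // ltW.
have b2 : 100 * b ^+ 2 <= delta.
  rewrite expr2 mulrA; apply: (@le_trans _ _ (delta * b)).
    by rewrite ler_wpM2r // ltW.
  by rewrite ler_piMr; lra.
have nE : (trunc_log 2 N).+1.*2.+1%:R = 2 * (trunc_log 2 N)%:R + 3 :> R.
  have dE n : (n.+1.*2.+1 = 2 * n + 3)%N by clear; lia.
  by rewrite dE natrD natrM.
have b20 : 0 <= b ^+ 2 by exact: sqr_ge0.
have -> : 640 * L * (trunc_log 2 N).+1.*2.+1%:R =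
    N%:R * (32 / 125 * b ^+ 2 * (2 * (trunc_log 2 N)%:R + 3) / l ^+ 2).
  by rewrite nE LE cE; field; rewrite gt_eqF.
have -> : 64 * L = N%:R * (16 / 625 * b ^+ 2 / l ^+ 2).
  by rewrite LE cE; field; rewrite gt_eqF.
split.
  rewrite ler_piMr // ler_pdivrMr ?exprn_gt0 // mul1r.
  apply: (@le_trans _ _ (32 / 125 * b ^+ 2 * (10 * l))).
    by rewrite ler_wpM2l ?mulr_ge0 //; lra.
  have bl : 64 / 25 * b ^+ 2 <= l by lra.
  by have := ler_wpM2r (ltW l0) bl; lra.
rewrite mulrC ler_wpM2r // ler_pdivrMr ?exprn_gt0 //.
have l2 : 4^-1 <= l ^+ 2.
  have -> : 4^-1 = (2^-1) ^+ 2 :> R by field.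
  by rewrite lerXn2r // nnegrE; lra.
by have := ler_wpM2l (ltW d0) l2; lra.
Qed.

(** * From the quadratic form to the empirical norm *)

Section Sandwich.
Context {R : realType} {T : ptopologicalType} {H : completeNormedModType R}.
Variables (K : T -> T -> R) (ip : H -> H -> R) (ev : H -> T -> R) (phi : T -> H).
Hypothesis rkhs : is_rkhs K ip ev phi.
Variables (sigma : nat -> R) (e : nat -> H) (k : nat).
Hypothesis ortho : forall i j : 'I_k, ip (e i) (e j) = (i == j)%:R.
Hypothesis sigma_gt0 : forall j, (j < k)%N -> 0 < sigma j.
Context {dS : measure_display} {S : measurableType dS}.
Variables (P : probability S R) (N : nat) (X : 'I_N -> {RV P >-> borelType T}).
Variables (r : R) (r_gt0 : 0 < r).

(** The coordinates of barGamma_(1:k)^(-1/2) phi(x) in the eigenbasis. *)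
Definition features (x : borelType T) : 'cV[R]_k :=
  \col_(j < k) (weight sigma r j * ev (e j) x).

Definition feature_moments : 'rV[R]_k :=
  \row_(j < k) (weight sigma r j ^+ 2 * sigma j).

(** The coordinates for which <rescaled a, features x> is the value at x of
    sum_j a_j e_j. *)
Definition rescaled (a : 'I_k -> R) : 'cV[R]_k :=
  \col_(j < k) (a j / weight sigma r j).

Let ipC := rkhs_ipC rkhs.
Let ip_linear := rkhs_ip_linear rkhs.

Lemma frob_features x : frob (features x) (features x) =
  `|barGamma1k_mhalf ip sigma e k r (phi x)| ^+ 2.
Proof.
rewrite (bar_norm_sqr rkhs) // frobE; apply: eq_bigr => j _.
by rewrite big_ord1 !mxE -expr2.
Qed.

Lemma rescaled_features (a : 'I_k -> R) x :
  \sum_j rescaled a j 0 * features x j 0 = ev (\sum_(j < k) a j *: e j) x.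
Proof.
rewrite (rkhs_reproducing rkhs) (ip_span ip_linear); apply: eq_bigr => j _.
rewrite !mxE -(rkhs_reproducing rkhs).
by field; rewrite gt_eqF // weight_gt0.
Qed.

Lemma rescaled_moments (a : 'I_k -> R) :
  \sum_j feature_moments 0 j * rescaled a j 0 ^+ 2 =
  \sum_(j < k) sigma j * a j ^+ 2.
Proof.
apply: eq_bigr => j _; rewrite !mxE.
by field; rewrite gt_eqF // weight_gt0.
Qed.

Lemma deviation_quad_form (a : 'I_k -> R) w :
  frob (rescaled a) (deviation X features feature_moments w *m rescaled a) =
  \sum_i ev (\sum_(j < k) a j *: e j) (X i w) ^+ 2 -
  N%:R * \sum_(j < k) sigma j * a j ^+ 2.
Proof.
rewrite /deviation mulmx_suml frobC.
have frob_suml (F : 'I_N -> 'cV[R]_k) h :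
    frob (\sum_i F i) h = \sum_i frob (F i) h.
  by elim/big_ind2: _ => [|A x B y <- <-|//]; rewrite ?frobDl //
    /frob trmx0 mul0mx mxtrace0.
rewrite frob_suml; under eq_bigr => i _.
  rewrite frobC frob_centered rescaled_features rescaled_moments; over.
by rewrite sumrB sumr_const card_ord mulr_natl.
Qed.

(** The cone is what keeps h in a ball whose radius is controlled by the L_2
    norm: 1 / w_j^2 <= r^2 + sigma_j. *)
Lemma rescaled_norm_le (a : 'I_k -> R) :
  r * Num.sqrt (\sum_j a j ^+ 2) <=
    Num.sqrt (\sum_(j < k) sigma j * a j ^+ 2) ->
  frob (rescaled a) (rescaled a) <= 2 * \sum_(j < k) sigma j * a j ^+ 2.
Proof.
move=> cone_a; set G := \sum_(j < k) sigma j * _ in cone_a *.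
have G_ge0 : 0 <= G.
  by apply: sumr_ge0 => j _; rewrite mulr_ge0 ?sqr_ge0 // ltW // sigma_gt0.
have ra_le : r ^+ 2 * \sum_j a j ^+ 2 <= G.
  have s0 : 0 <= \sum_j a j ^+ 2 by apply: sumr_ge0 => j _; exact: sqr_ge0.
  move: cone_a; rewrite -(@ler_pXn2r _ 2) ?nnegrE ?mulr_ge0 ?sqrtr_ge0 ?(ltW r_gt0) //.
  by rewrite exprMn !sqr_sqrtr.
apply: (@le_trans _ _ (r ^+ 2 * (\sum_j a j ^+ 2) + G)); last lra.
rewrite frobE mulr_sumr -big_split /=; apply: ler_sum => j _.
rewrite big_ord1 !mxE -expr2 exprMn mulrC -mulrDl.
by rewrite ler_wpM2r ?sqr_ge0 // weight_inv_sqr_le.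
Qed.

Lemma design_norm_span (a : 'I_k -> R) w :
  design_norm X ip phi e k w (\sum_(j < k) a j *: e j) =
  Num.sqrt (\sum_i ev (\sum_(j < k) a j *: e j) (X i w) ^+ 2).
Proof.
congr Num.sqrt; apply: eq_bigr => i _.
by rewrite (ip_proj1k ipC ip_linear ortho) ipC -(rkhs_reproducing rkhs).
Qed.

Lemma sandwich (a : 'I_k -> R) w : (0 < N)%N ->
  r * Num.sqrt (\sum_j a j ^+ 2) <=
    Num.sqrt (\sum_(j < k) sigma j * a j ^+ 2) ->
  `|frob (rescaled a) (deviation X features feature_moments w *m rescaled a)| <=
    N%:R / 4 * frob (rescaled a) (rescaled a) ->
  let f := \sum_(j < k) a j *: e j in
  let g := Num.sqrt (\sum_(j < k) sigma j * a j ^+ 2) in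
  2^-1 * g <= (Num.sqrt N%:R)^-1 * design_norm X ip phi e k w f /\
  (Num.sqrt N%:R)^-1 * design_norm X ip phi e k w f <= 2 * g.
Proof.
move=> N_gt0 cone_a dev_le f g.
have N0 : 0 < N%:R :> R by rewrite ltr0n.
rewrite /f design_norm_span -/f /g.
move: dev_le; rewrite deviation_quad_form -/f.
set G := \sum_(j < k) sigma j * _; set Q := \sum_i _ => dev_le.
have G_ge0 : 0 <= G.
  by apply: sumr_ge0 => j _; rewrite mulr_ge0 ?sqr_ge0 // ltW // sigma_gt0.
have Q_ge0 : 0 <= Q by apply: sumr_ge0 => i _; exact: sqr_ge0.
have N4 : 0 <= N%:R / 4 :> R by rewrite divr_ge0.
have := le_trans dev_le (ler_wpM2l N4 (rescaled_norm_le cone_a)).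
rewrite -/G ler_norml => /andP[lo hi].
have NG : 0 <= N%:R * G by rewrite mulr_ge0.
have sN : 0 <= (Num.sqrt N%:R)^-1 :> R by rewrite invr_ge0 sqrtr_ge0.
have half0 : 0 <= 2^-1 :> R by rewrite invr_ge0.
have NQ : (Num.sqrt N%:R)^-1 ^+ 2 * Num.sqrt Q ^+ 2 = Q / N%:R.
  by rewrite exprVn !sqr_sqrtr // mulrC.
split; rewrite -(@ler_pXn2r _ 2) ?nnegrE ?mulr_ge0 ?sqrtr_ge0 //.
  rewrite exprMn [leRHS]exprMn NQ sqr_sqrtr // ler_pdivlMr //; lra.
rewrite exprMn [leRHS]exprMn NQ sqr_sqrtr // ler_pdivrMr //; lra.
Qed.

End Sandwich.

(** * The equivalence of norms on the cone *)

Unset Implicit Arguments.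

Theorem proposition3 (R : realType) (delta : R) (hdelta : 0 < delta < 1) :
  exists Ca Cb cl Cu : R,
    [/\ 0 < Ca, 0 < Cb, 0 < cl & 0 < Cu] /\
    forall (cR : R), 0 < cR < (100 * Ca ^+ 2 * Cb ^+ 2)^-1 ->
    forall (T : ptopologicalType) (K : T -> T -> R)
      (mu : probability (borelType T) R)
      (H : completeNormedModType R) (ip : H -> H -> R)
      (ev : H -> T -> R) (phi : T -> H) (Gamma : H -> H)
      (sigma : nat -> R) (e : nat -> H) (k : nat)
      (dS : measure_display) (S : measurableType dS) (P : probability S R)
      (N : nat) (X : 'I_N -> {RV P >-> borelType T}) (r : R),
    hausdorff_space T -> compact [set: T] ->
    continuous (fun xy : T * T => K xy.1 xy.2) ->
    positive_definite_kernel K ->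
    (forall x y, `|K x y| <= 1) ->
    is_rkhs K ip ev phi ->
    is_second_moment ip mu phi Gamma ->
    is_spectral_decomposition ip Gamma sigma e ->
    (forall j, (j < k)%N -> 0 < sigma j) ->
    (1 < N)%N ->
    iid_with_law X mu ->
    0 < r -> R_N X ip phi sigma e k cR <= r ->
    cone (setC1k ip sigma e k r) = coneC1k mu ev e k r /\
    exists E : set S, [/\ measurable E, ((1 - delta)%:E <= P E)%E &
      forall w, E w -> forall f, cone (setC1k ip sigma e k r) f ->
        cl * `|Gamma1k_half ip sigma e k f| <=
          (Num.sqrt N%:R)^-1 * design_norm X ip phi e k w f /\
        (Num.sqrt N%:R)^-1 * design_norm X ip phi e k w f <=
          Cu * `|Gamma1k_half ip sigma e k f|].
Proof.
have /andP[d0 d1] := hdelta.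
(* These Ca and Cb force c_R < delta^2 / 10^4, small enough for
   sample_size_arith. *)
exists 10, delta^-1, 2^-1, 2; split; first by split; rewrite ?invr_gt0.
move=> c hc T K mu H ip ev phi Gamma sigma e k dS S P N X r _ _ cK _ K_le1.
move=> rkhs GammaE spectral sigma_gt0 N_gt1 iid r_gt0 le_r.
have coneE := cone_setC1k cK K_le1 rkhs GammaE spectral sigma_gt0 r_gt0.
split=> //.
have ortho := eigen_ortho spectral sigma_gt0.
have mX i : measurable_fun setT (X i) by exact: measurable_funPT.
pose L := 4 * (c * (Num.sqrt N%:R / ln N%:R)) ^+ 2.
have [LN Ld] := sample_size_arith hdelta hc N_gt1.
have bev f : bmeas (ev f : borelType T -> R) := bmeas_ev cK K_le1 rkhs f.
pose y := features ev sigma e k r.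
have b_feat p : bmeas (fun x => y x p 0).
  have := bmeasZ (weight sigma r p) (bev (e p)).
  by congr bmeas; apply/funext => x; rewrite mxE.
have moments i p q : Ex P (fun w => y (X i w) p 0 *
    y (X i w) q 0) =
    diag_mx (feature_moments sigma k r) p q.
  rewrite (Ex_law iid i (bmeasM (b_feat p) (b_feat q))).
  transitivity (Ex mu (fun x => weight sigma r p * weight sigma r q *
      (ev (e p) x * ev (e q) x))).
    by congr Ex; apply/funext => x; rewrite !mxE; ring.
  rewrite ExZ; last exact: bmeasM.
  rewrite (Ex_ev_eigen rkhs GammaE spectral sigma_gt0) !mxE.
  by have [->|] := eqVneq p q; rewrite ?mulr1 ?mulr0 ?mulr1n ?mulr0n //; ring.
have y_le i : {ae P, forall w, frob (y (X i w))
    (y (X i w)) <= L}.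
  have c0 : 0 < c by case/andP: hc.
  apply: filterS (R_N_bound K_le1 rkhs ortho sigma_gt0 N_gt1 c0 r_gt0 le_r i).
  by move=> w; rewrite (frob_features rkhs) //.
have d_ge0 (j : 'I_k) : 0 <= feature_moments sigma k r 0 j.
  by rewrite mxE mulr_ge0 ?sqr_ge0 // ltW // sigma_gt0.
have d_le1 (j : 'I_k) : feature_moments sigma k r 0 j <= 1.
  by rewrite mxE weight_sqr_sigma_le1.
have [E [mE PE devE]] := deviation_concentration mX (Ex_prod_indic iid) b_feat
  moments y_le d_ge0 d_le1 (ltnW N_gt1) (ltnW (trunc_log_ltn N (isT : (1 < 2)%N)))
  (ltW d0) LN Ld.
exists E; split=> // w Ew f; rewrite coneE => cone_f.
have [[a fE] _] := cone_f.
move: cone_f; rewrite fE.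
move=> /(coneC1k_spanP cK K_le1 rkhs GammaE spectral sigma_gt0) cone_a.
rewrite (norm_Gamma1k_half rkhs spectral sigma_gt0).
exact: (sandwich rkhs ortho sigma_gt0 r_gt0 (ltnW N_gt1) cone_a (devE w _ Ew)).
Qed.
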